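(* Let $\omega$ be a symplectic form on $V=\mathbb{R}^{2n}$ and let $P\in \mathrm{Gr}^\omega_2(\mathcal{Q})$ be an $\omega$-regular pencil, i.e. such that all its non-zero elements are $\omega$-regular. Then $\mathbb{P}(P^\circ)$ intersects transversely the manifold $\mathbb{X}_{\mathrm{Sp}}\subset\mathbb{P}(S^2V^{>0})$ in a codimension $2$ submanifold.
   Context: $S^2V$ is the space of symmetric tensors (viewed as maps $V^*\to V$) and $\mathcal{Q}=S^2V^*$ its dual, the space of symmetric bilinear forms on $V$ (viewed as maps $V\to V^*$), with pairing $q(s)=\mathrm{Tr}(q\circ s)$. $S^2V^{>0}$ is the set of positive definite tensors. $\mathrm{Gr}_2(\mathcal{Q})$ is the Grassmannian of planes in $\mathcal{Q}$ (pencils), and $P^\circ=\{s\in S^2V:q(s)=0\ \forall q\in P\}$. An element $q\in\mathcal{Q}$ is $\omega$-regular if there are Lagrangians $\ell^+,\ell^-$ of $(V,\omega)$ such that $q$ is positive definite on $\ell^+$ and negative definite on $\ell^-$. $\mathrm{Gr}_2^\omega(\mathcal{Q})$ is the set of pencils whose non-zero elements are all $\omega$-regular. $\mathbb{X}_{\mathrm{Sp}}\subset\mathbb{P}(S^2V^{>0})$ is the set of classes $[q^{-1}]$, with $q\in\mathcal{Q}$ positive definite, compatible with $\omega$: for some complex structure $J$ on $\mathbb{R}^{2n}$ the form $q+i\omega$ is a $J$-Hermitian metric on $V$. It is a copy of the symmetric space of $\mathrm{Sp}(2n,\mathbb{R})$. *)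

(* Defs.v *)
From HB Require Import structures.
From mathcomp Require Import all_boot all_order all_algebra.
From mathcomp Require Import all_classical all_reals all_analysis.
From mathcomp Require Import complex.

Set Implicit Arguments.
Unset Strict Implicit.
Unset Printing Implicit Defensive.

Import Order.TTheory GRing.Theory Num.Theory.
Import numFieldNormedType.Exports.

Local Open Scope classical_set_scope.
Local Open Scope ring_scope.

(* f is C^k on D: all iterated directional derivatives of order at most k,
   along directions in E, exist and are continuous on D. It is used with E a
   linear subspace of V and D relatively open in E; only the values of f on D
   matter then. *)
Fixpoint is_Ck (R : realType) (V W : normedModType R) (k : nat)
    (E D : set V) (f : V -> W) : Prop :=
  {within D, continuous f} /\
  if k is k'.+1 then
    forall v, E v ->
      (forall x, D x -> derivable f x v) /\ is_Ck k' E D ('D_v f)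
  else True.

Definition is_smooth (R : realType) (V W : normedModType R)
    (E D : set V) (f : V -> W) : Prop := forall k, is_Ck k E D f.

(* Projective geometry of a linear subspace E (a set closed under linear
   combinations) of 'M[R]_m. A point of P(E) is the line <[s]> spanned by a
   nonzero s in E, and P(E) has the quotient topology and the quotient smooth
   structure of E \ {0}: openness, smoothness and differentials are read on
   the lifts to E \ {0}. *)
Section Projective.
Variables (R : realType) (m : nat).
Local Notation M := 'M[R]_m.
Implicit Types (E : set M) (X Y N : set {vspace M}).

Definition proj_space (E : set M) : set {vspace M} :=
  [set l | exists s, [/\ E s, s != 0 & l = <[s]>%VS]].

Definition proj_lift E X : set M := [set s | [/\ E s, s != 0 & X <[s]>%VS]].

Definition proj_open E X : Prop :=
  X `<=` proj_space E /\ exists2 O : set M, open O & proj_lift E X = E `&` O.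

Definition is_submersion E (U : set {vspace M}) c
    (phi : 'I_c -> {vspace M} -> R) : Prop :=
  let f i : M -> R := fun s => phi i <[s]>%VS in
  (forall i, is_smooth E (proj_lift E U) (f i)) /\
  (forall s, proj_lift E U s -> forall w : 'I_c -> R,
     exists2 v, E v & forall i, 'D_v (f i) s = w i).

(* X is an embedded submanifold of P(E) of codimension c: it is locally the
   zero set of a smooth submersion to R^c (in particular the empty set is a
   submanifold of every codimension). *)
Definition is_submanifold E c X : Prop :=
  X `<=` proj_space E /\
  forall x, X x -> exists (U : set {vspace M}) (phi : 'I_c -> {vspace M} -> R),
    [/\ proj_open E U, U x, is_submersion E U phi &
        X `&` U = [set y | U y /\ forall i, phi i y = 0]].

Definition is_submanifold_in E c X N : Prop :=
  N `<=` X /\ exists k, is_submanifold E k X /\ is_submanifold E (k + c)%N N.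

(* For s in E \ {0} spanning a point x of X, this is the preimage of T_x X
   under the differential at s of E \ {0} -> P(E), whose kernel is <[s]>:
   the velocities at s of the smooth curves in E \ {0} that start at s and
   whose projection to P(E) stays in X. *)
Definition lifted_tangent E X (s : M) : set M :=
  [set w | exists (e : R) (g : R -> M),
     [/\ 0 < e, is_smooth setT (ball (0 : R) e) g,
         forall t, ball (0 : R) e t -> proj_lift E X (g t),
         g 0 = s & derive1 g 0 = w]].

(* T_x X + T_x Y = T_x P(E) at every x in X `&` Y; as the lifted tangent
   spaces contain the kernel <[s]>, this is an equality in E. *)
Definition transverse E X Y : Prop :=
  forall s, proj_lift E (X `&` Y) s -> forall w, E w ->
    exists w1 w2, [/\ lifted_tangent E X s w1, lifted_tangent E Y s w2 &
                      w = w1 + w2].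

End Projective.

(* V = R^m is 'cV[R]_m. Bilinear forms on V (maps V -> V^* ) and tensors (maps
   V^* -> V) are matrices in the canonical basis and its dual. *)
Section Forms.
Variables (R : realType) (m : nat).
Implicit Types (q s A omega J : 'M[R]_m) (L : {vspace 'cV[R]_m}).

Definition bilin A (u v : 'cV[R]_m) : R := (u^T *m A *m v) 0 0.

Definition symmetric_mx : set 'M[R]_m := [set A | A^T = A].

Definition posdef A : Prop := forall u, u != 0 -> 0 < bilin A u u.

Definition symplectic_form omega : Prop :=
  omega^T = - omega /\ omega \in unitmx.

Definition is_lagrangian omega L : Prop :=
  (\dim L * 2 = m)%N /\
  forall u v, u \in L -> v \in L -> bilin omega u v = 0.

Definition omega_regular omega q : Prop :=
  exists Lp Lm, [/\ is_lagrangian omega Lp, is_lagrangian omega Lm,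
    forall u, u \in Lp -> u != 0 -> 0 < bilin q u u &
    forall u, u \in Lm -> u != 0 -> bilin q u u < 0].

(* The planes of Q = symmetric_mx. *)
Definition is_pencil (P : {vspace 'M[R]_m}) : Prop :=
  \dim P = 2%N /\ forall q, q \in P -> symmetric_mx q.

Definition regular_pencil omega (P : {vspace 'M[R]_m}) : Prop :=
  is_pencil P /\ forall q, q \in P -> q != 0 -> omega_regular omega q.

Definition pencil_annihilator (P : {vspace 'M[R]_m}) : set 'M[R]_m :=
  [set s | symmetric_mx s /\ forall q, q \in P -> \tr (q *m s) = 0].

Definition is_hermitian_metric J (h : 'cV[R]_m -> 'cV[R]_m -> R[i]) : Prop :=
  [/\ forall (a : R) u v w, h (a *: u + v) w = (a%:C)%C * h u w + h v w,
      forall u v, h (J *m u) v = ('i)%C * h u v,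
      forall u v, h v u = (h u v)^*%C &
      forall u, u != 0 -> 0 < h u u].

Definition compatible omega q : Prop :=
  exists J, J *m J = - 1%:M /\
    is_hermitian_metric J (fun u v => (bilin q u v +i* bilin omega u v)%C).

Definition X_Sp omega : set {vspace 'M[R]_m} :=
  [set l | exists q, [/\ symmetric_mx q, posdef q, compatible omega q &
                         l = <[invmx q]>%VS]].

End Forms.

(* Main.v *)
Require Import Defs.
From HB Require Import structures.
From mathcomp Require Import all_boot all_order all_algebra.
From mathcomp Require Import all_classical all_reals all_analysis.
From mathcomp Require Import complex ring lra.

(* Write q^-1 = s. The tensors in X_Sp are, up to scale, the positive definite
   s with (s omega)^2 = -1. Fix one of them, s0, and let W be the space of
   trace-free C that are self-adjoint for the Hermitian metric of s0.

   Equations of X_Sp. On the cone of positive definite s, [s] lies in X_Sp iff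
   tr(C (s omega)^2) = 0 for all C in W. Indeed the trace-free part B of
   (s omega)^2 is self-adjoint for s; the equations make it anticommute with
   s0 omega, hence skew-adjoint for s0; so tr(B^2) is both >= 0 and <= 0, and
   B = 0. The same trick shows that no C <> 0 in W kills the differential of
   (s omega)^2, so X_Sp has codimension dim W.

   Intersection with P(P°). If the equations of X_Sp and those of P° had
   dependent differentials at s, some nonzero q in P would be invariant under
   J = s omega (up to scale). Then q is positive on L and on J L for a
   Lagrangian L, and V is the s^-1-orthogonal sum of L and J L, so tr(q s) > 0,
   against s in P°. This gives the independence of the equations of the
   intersection, and transversality because T X_Sp is spanned by the velocities
   of products of transvections acting on s. *)

Set Implicit Arguments.
Unset Strict Implicit.
Unset Printing Implicit Defensive.

Import Order.TTheory GRing.Theory Num.Theory.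
Import numFieldNormedType.Exports.

Local Open Scope classical_set_scope.
Local Open Scope ring_scope.

(** * Positive definite forms, Cholesky factorisation and signs of traces *)

Section PositiveForms.
Variable R : realType.

(** One-sided inverses are two-sided also when [p] and [m] are equal only propositionally, as for
    [\dim L + \dim L] and [m] below. *)
Lemma mulmx1_flip p m (pm : p = m) (A : 'M[R]_(m, p)) (B : 'M[R]_(p, m)) :
  B *m A = 1%:M -> A *m B = 1%:M.
Proof. by case: m / pm A B => A B /mulmx1C. Qed.

Lemma bilinDl m (A : 'M[R]_m) u v w :
  bilin A (u + v) w = bilin A u w + bilin A v w.
Proof. by rewrite /bilin linearD /= !mulmxDl mxE. Qed.

Lemma bilin_mul m p (A : 'M[R]_m) (X : 'M[R]_(m, p)) u v :
  bilin (X^T *m A *m X) u v = bilin A (X *m u) (X *m v).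
Proof. by rewrite /bilin trmx_mul !mulmxA. Qed.

Lemma bilin1 m (u : 'cV[R]_m) : bilin 1%:M u u = \sum_i u i 0 ^+ 2.
Proof.
rewrite /bilin mulmx1 mxE; apply: eq_bigr => i _; by rewrite mxE expr2.
Qed.

Lemma bilinD m (A B : 'M[R]_m) u v :
  bilin (A + B) u v = bilin A u v + bilin B u v.
Proof. by rewrite /bilin mulmxDr mulmxDl mxE. Qed.

Lemma bilinZ m a (A : 'M[R]_m) u v : bilin (a *: A) u v = a * bilin A u v.
Proof. by rewrite /bilin -scalemxAr -scalemxAl mxE. Qed.

Lemma posdef_unitmx m (A : 'M[R]_m) : posdef A -> A \in unitmx.
Proof.
move=> Apos; rewrite -unitmx_tr -row_free_unit -kermx_eq0; apply/eqP/row_matrixP => i.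
rewrite row0; set k := row i _.
have kA : k *m A^T = 0 by rewrite /k -row_mul mulmx_ker row0.
apply/eqP; rewrite -[k]trmxK -[0]trmxK (inj_eq trmx_inj) trmx0; apply: contraT => /Apos.
by rewrite /bilin trmxK -[A]trmxK -mulmxA -trmx_mul kA trmx0 mulmx0 mxE ltxx.
Qed.

Lemma posdef_congr m (A X : 'M[R]_m) :
  X \in unitmx -> posdef A -> posdef (X^T *m A *m X).
Proof.
move=> Xu Apos u u0; rewrite bilin_mul; apply: Apos; apply: contra u0 => /eqP Xu0.
by rewrite -[u](mulKmx Xu) Xu0 mulmx0.
Qed.

(** Induction on the size: eliminating the first row and column with the unipotent [E] leaves the
    Schur complement [S], again symmetric and positive definite. *)
Lemma cholesky m (A : 'M[R]_m) : A^T = A -> posdef A ->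
  exists2 C, C \in unitmx & A = C *m C^T.
Proof.
elim: m A => [|m IH] A symA posA.
  by exists 1%:M; rewrite ?unitmx1 //; apply/matrixP => -[].
pose A' : 'M[R]_(1 + m) := A.
pose a := A 0 0; pose b := dlsubmx A'; pose D := drsubmx A'.
have ea : ulsubmx A' = a%:M.
  apply/matrixP => i j; rewrite !mxE !ord1 eqxx mulr1n.
  by congr (A' _ _); apply/val_inj.
have eb : ursubmx A' = b^T by rewrite /b trmx_dlsub symA.
have eA : A' = block_mx a%:M b^T b D by rewrite -ea -eb submxK.
have a0 : 0 < a.
  have := posA (delta_mx 0 0); rewrite /bilin trmx_delta -rowE -colE !mxE; apply.
  by apply/eqP => /matrixP /(_ 0 0) /eqP; rewrite !mxE !eqxx oner_eq0.
pose E : 'M[R]_(1 + m) := block_mx 1%:M 0 (- a^-1 *: b) 1%:M.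
pose S := D - a^-1 *: (b *m b^T).
have eS : E *m A' *m E^T = block_mx a%:M 0 0 S.
  rewrite /E eA tr_block_mx !mulmx_block
    !(trmx1, trmx0, mul1mx, mulmx1, mul0mx, mulmx0, addr0, add0r).
  rewrite linearZ /= !(mul_scalar_mx, mul_mx_scalar) -!scalemxAr -!scalemxAl !scalerA.
  rewrite !mulrN !mulfV ?gt_eqF // !scaleN1r !addNr mul0mx scaler0 add0r.
  by rewrite addrC scaleNr.
have Eu : E \in unitmx by rewrite unitmxE det_lblock !det1 mulr1 unitr1.
have posS : posdef S.
  move=> u u0; have := @posdef_congr _ A' E^T; rewrite unitmx_tr trmxK eS => /(_ Eu posA).
  move=> /(_ (col_mx 0 u)); rewrite /bilin tr_col_mx mul_row_block.
  rewrite !(trmx0, mul0mx, mulmx0, addr0, add0r) mul_row_col mul0mx add0r; apply.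
  by rewrite col_mx_eq0 negb_and u0 orbT.
have symS : S^T = S.
  rewrite /S linearB linearZ /= trmx_mul trmxK; congr (_ - _).
  by rewrite /D trmx_drsub symA.
have [C Cu eSC] := IH S symS posS.
have [Eiu EE] : invmx E \in unitmx /\ E^T *m invmx E^T = 1%:M.
  by rewrite unitmx_inv mulmxV // unitmx_tr.
pose G : 'M[R]_(1 + m) := block_mx (Num.sqrt a)%:M 0 0 C.
have Gu : G \in unitmx.
  rewrite unitmxE det_lblock det_scalar1 unitrM -unitmxE Cu andbT.
  by rewrite unitfE sqrtr_eq0 -ltNge a0.
have GG : G *m G^T = E *m A' *m E^T.
  rewrite tr_block_mx mulmx_block !(trmx0, mul0mx, mulmx0, addr0, add0r).
  by rewrite tr_scalar_mx -eSC -scalar_mxM -expr2 sqr_sqrtr ?ltW // eS.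
exists (invmx E *m G); first by rewrite unitmx_mul Eiu Gu.
rewrite trmx_mul mulmxA -[_ *m G *m _]mulmxA GG -2!mulmxA trmx_inv !mulmxA.
by rewrite mulVmx // mul1mx -mulmxA EE mulmx1.
Qed.

Lemma mxtrace_gram m p (X : 'M[R]_(m, p)) :
  \tr (X^T *m X) = \sum_i \sum_j X j i ^+ 2.
Proof.
rewrite /mxtrace; apply: eq_bigr => i _; rewrite mxE; apply: eq_bigr => j _.
by rewrite mxE expr2.
Qed.

Lemma mxtrace_gram_ge0 m p (X : 'M[R]_(m, p)) : 0 <= \tr (X^T *m X).
Proof. by rewrite mxtrace_gram; do 2!apply: sumr_ge0 => ? _; exact: sqr_ge0. Qed.

Lemma mxtrace_gram_eq0 m p (X : 'M[R]_(m, p)) : \tr (X^T *m X) = 0 -> X = 0.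
Proof.
rewrite mxtrace_gram => h; apply/matrixP => j i; rewrite mxE.
have ge0 k : 0 <= \sum_j X j k ^+ 2 by apply: sumr_ge0 => ? _; exact: sqr_ge0.
have hi := psumr_eq0P (fun k _ => ge0 k) h (i := i) isT.
have /eqP := psumr_eq0P (fun k _ => sqr_ge0 (X k i)) hi (i := j) isT.
by rewrite sqrf_eq0 => /eqP.
Qed.

(* In an s-orthonormal frame, B becomes symmetric (resp. skew) when
   B s = s B^T (resp. B s = - s B^T). *)
Lemma orthonormal_frame m (s B : 'M[R]_m) : s^T = s -> posdef s ->
  exists2 Y : 'M[R]_m,
    \tr (B *m B) = \tr (Y *m Y) /\ (Y = 0 -> B = 0) &
    (B *m s = s *m B^T -> Y^T = Y) /\ (B *m s = - (s *m B^T) -> Y^T = - Y).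
Proof.
move=> symS /cholesky [//|C Cu ->].
have Ctu : C^T \in unitmx by rewrite unitmx_tr.
have eB : B = C *m (invmx C *m B *m C) *m invmx C.
  by rewrite !mulmxA mulmxV // mul1mx mulmxK.
exists (invmx C *m B *m C); split.
- rewrite {1 2}eB; move: (invmx C *m B *m C) => Y.
  by rewrite -!mulmxA mulKmx // mxtrace_mulC -!mulmxA mulVmx // mulmx1.
- by move=> Y0; rewrite eB Y0 mulmx0 mul0mx.
- rewrite !trmx_mul trmx_inv !mulmxA => e.
  have {}e : C^T *m B^T = invmx C *m B *m C *m C^T.
    by apply: (can_inj (mulKmx Cu)); rewrite !mulmxA -e mulmxV // mul1mx.
  by rewrite e mulmxK.
- rewrite !trmx_mul trmx_inv !mulmxA => e.
  have {}e : C^T *m B^T = - (invmx C *m B *m C *m C^T).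
    by apply: (can_inj (mulKmx Cu)); rewrite mulmxN !mulmxA mulmxV // mul1mx e opprK.
  by rewrite e mulNmx mulmxK.
Qed.

(** In an orthonormal frame [B] becomes a symmetric [Y], so the trace of the square is that of
    [Y^T *m Y], a sum of squares. The relation [B *m s = s *m B^T] is self-adjointness for the inner
    product [s^-1] on V. *)
Lemma mxtrace_selfadjoint m (s B : 'M[R]_m) : s^T = s -> posdef s ->
  B *m s = s *m B^T -> 0 <= \tr (B *m B) /\ (\tr (B *m B) = 0 -> B = 0).
Proof.
move=> symS posS e; have [Y [-> YB] [/(_ e) YT _]] := orthonormal_frame B symS posS.
rewrite -{1 3}YT; split; first exact: mxtrace_gram_ge0.
by move/mxtrace_gram_eq0/YB.
Qed.

Lemma mxtrace_skewadjoint m (s B : 'M[R]_m) : s^T = s -> posdef s ->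
  B *m s = - (s *m B^T) -> \tr (B *m B) <= 0 /\ (\tr (B *m B) = 0 -> B = 0).
Proof.
move=> symS posS e; have [Y [-> YB] [_ /(_ e) YT]] := orthonormal_frame B symS posS.
rewrite -[X in X *m _]opprK -YT mulNmx linearN /= oppr_le0 mxtrace_gram_ge0.
by split=> // /eqP; rewrite oppr_eq0 => /eqP/mxtrace_gram_eq0/YB.
Qed.

(** The trace of [B *m B] is nonnegative by self-adjointness for one inner product and nonpositive
    by skew-adjointness for the other. This is the source of both the equations of [X_Sp] and their
    independence. *)
Lemma selfadjoint_skewadjoint_eq0 m (s t B : 'M[R]_m) :
  s^T = s -> posdef s -> t^T = t -> posdef t ->
  B *m s = s *m B^T -> B *m t = - (t *m B^T) -> B = 0.
Proof.
move=> sS sP tS tP /(mxtrace_selfadjoint sS sP) [ge0 eq0].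
by move=> /(mxtrace_skewadjoint tS tP) [le0 _]; apply: eq0; apply/le_anti/andP.
Qed.

End PositiveForms.

(** * Compatible tensors: the equation of [X_Sp] without the complex structure *)

Section CompatibleTensors.
Variables (R : realType) (m : nat) (omega : 'M[R]_m).
Hypotheses (omegaT : omega^T = - omega) (omegaU : omega \in unitmx).
Implicit Types (s C q p : 'M[R]_m).

Lemma bilin_inj (A B : 'M[R]_m) : (forall u v, bilin A u v = bilin B u v) -> A = B.
Proof.
move=> e; apply/matrixP => i j; have := e (delta_mx i 0) (delta_mx j 0).
by rewrite /bilin !trmx_delta -!rowE -!colE !mxE.
Qed.

Lemma bilin_tr (A : 'M[R]_m) u v : bilin A^T u v = bilin A v u.
Proof.
have -> : bilin A v u = (v^T *m A *m u)^T 0 0 by rewrite mxE.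
by rewrite !trmx_mul trmxK mulmxA.
Qed.

Lemma bilinMl (A J : 'M[R]_m) u v : bilin A (J *m u) v = bilin (J^T *m A) u v.
Proof. by rewrite /bilin trmx_mul !mulmxA. Qed.

Lemma bilinZl a (A : 'M[R]_m) u v : bilin A (a *: u) v = a * bilin A u v.
Proof. by rewrite /bilin linearZ /= -!scalemxAl mxE. Qed.

Lemma bilinNm (A : 'M[R]_m) u v : bilin (- A) u v = - bilin A u v.
Proof. by rewrite /bilin mulmxN mulNmx mxE. Qed.

Lemma bilin_skew u : bilin omega u u = 0.
Proof.
have := bilin_tr omega u u; rewrite omegaT bilinNm => e.
by apply/eqP; lra.
Qed.

Lemma posdef_invmx q : q^T = q -> posdef q -> posdef (invmx q).
Proof.
move=> symq posq; have qU := posdef_unitmx posq.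
rewrite -[invmx q]mul1mx -(mulVmx qU) -[X in X *m _ *m _]trmxK trmx_inv symq.
by apply: posdef_congr => //; rewrite unitmx_inv.
Qed.

(** Comparing real and imaginary parts in [h (J *m u) v = 'i * h u v] gives [J^T q = - omega] and
    [J^T omega = q]; eliminating [J] leaves an equation in [s = q^-1] alone. Conversely
    [J = s omega] is a suitable complex structure. *)
Lemma X_SpP (l : {vspace 'M[R]_m}) : X_Sp omega l <->
  exists s, [/\ s^T = s, posdef s, s *m omega *m s *m omega = - 1%:M & l = <[s]>%VS].
Proof.
split=> [[q [symq posq [J [JJ [_ hJ _ _]]] ->]]|[s [symS posS eS ->]]].
  have qU := posdef_unitmx posq.
  have eJ u v : bilin (J^T *m q) u v = bilin (- omega) u v /\
                bilin (J^T *m omega) u v = bilin q u v.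
    have /eqP := hJ u v; rewrite eq_complex /= => /andP[/eqP e1 /eqP e2].
    by rewrite -!bilinMl e1 e2 bilinNm; split; ring.
  have e1 : J^T *m q = - omega by apply: bilin_inj => u v; case: (eJ u v).
  have e2 : J^T *m omega = q by apply: bilin_inj => u v; case: (eJ u v).
  have eJT : J^T = q *m invmx omega by rewrite -e2 mulmxK.
  have eo : omega = - (q *m invmx omega *m q) by rewrite -eJT e1 opprK.
  exists (invmx q); split => //.
  - by rewrite trmx_inv symq.
  - exact: posdef_invmx.
  - have -> : invmx q *m omega = - (invmx omega *m q).
      by rewrite {1}eo mulmxN !mulmxA mulVmx // mul1mx.
    by rewrite !mulNmx mulmxK // mulVmx.
have sU := posdef_unitmx posS.
have eq : omega *m s *m omega = - invmx s.
  by apply: (can_inj (mulKmx sU)); rewrite !mulmxA eS mulmxN mulmxV.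
exists (invmx s); split; last by rewrite invmxK.
- by rewrite /symmetric_mx /= trmx_inv symS.
- exact: posdef_invmx.
exists (s *m omega); split; first by rewrite !mulmxA.
have eJT : (s *m omega)^T = - (omega *m s) by rewrite trmx_mul symS omegaT mulNmx.
have e1 : (s *m omega)^T *m invmx s = - omega by rewrite eJT mulNmx mulmxK.
have e2 : (s *m omega)^T *m omega = invmx s by rewrite eJT mulNmx eq opprK.
have symI : (invmx s)^T = invmx s by rewrite trmx_inv symS.
split=> [a u v w|u v|u v|u u0].
- rewrite !bilinDl; apply/eqP; rewrite eq_complex /=; apply/andP.
  by rewrite !bilinZl; split; apply/eqP; ring.
- rewrite !bilinMl e1 e2 bilinNm; apply/eqP; rewrite eq_complex /=; apply/andP.
  by split; apply/eqP; ring.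
- by rewrite -[in LHS]symI -[omega in LHS]opprK -omegaT bilinNm !bilin_tr.
- by rewrite bilin_skew ltcE /= eqxx posdef_invmx.
Qed.


End CompatibleTensors.

(** * Trace-free Hermitian endomorphisms and the quadratic equations of [X_Sp] *)

Section HermitianEndomorphisms.
Variables (R : realType) (m : nat) (omega : 'M[R]_m).
Hypotheses (omegaT : omega^T = - omega) (omegaU : omega \in unitmx).
Implicit Types (s C q p : 'M[R]_m).

(** The first two components vanish together exactly when [C] is self-adjoint for [s0] and commutes
    with [s0 omega]. The trace is packed as a 1 by 1 matrix so that the target is a product of
    matrix spaces. *)
Definition hermitian_defect (s0 C : 'M[R]_m) : 'M[R]_m * 'M[R]_m * 'rV[R]_1 :=
  (C *m s0 - s0 *m C^T, omega *m C - C^T *m omega, (\tr C)%:M).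

Fact hermitian_defect_is_linear (s0 : 'M[R]_m) : linear (hermitian_defect s0).
Proof.
move=> a C D; have eT : (a *: C + D)^T = a *: C^T + D^T by rewrite linearP.
apply: injective_projections; first apply: injective_projections => /=.
- by rewrite eT mulmxDl mulmxDr -scalemxAl -scalemxAr scalerBr opprD addrACA.
- by rewrite eT mulmxDl mulmxDr -scalemxAl -scalemxAr scalerBr opprD addrACA.
- by rewrite /= linearP raddfD /= -scale_scalar_mx.
Qed.

HB.instance Definition _ (s0 : 'M[R]_m) :=
  GRing.isLinear.Build R _ _ _ (hermitian_defect s0) (hermitian_defect_is_linear s0).

(* The trace-free endomorphisms that are self-adjoint for the Hermitian
   metric of s0. *)
Definition traceless_hermitian (s0 : 'M[R]_m) : {vspace 'M[R]_m} :=
  lker (linfun (hermitian_defect s0)).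

Lemma traceless_hermitianP (s0 C : 'M[R]_m) :
  reflect [/\ C *m s0 = s0 *m C^T, omega *m C = C^T *m omega & \tr C = 0]
          (C \in traceless_hermitian s0).
Proof.
rewrite memv_ker lfunE /=; apply: (iffP eqP) => [[/subr0_eq e1 /subr0_eq e2 e3]|[e1 e2 e3]].
  by split=> //; have /matrixP /(_ 0 0) := e3; rewrite !mxE.
by rewrite /hermitian_defect e1 e2 e3 !subrr raddf0.
Qed.

Definition quad C s : R := \tr (C *m (s *m omega *m s *m omega)).

(** The gradient of [quad C] at [s] for the trace pairing. *)
Definition dual_quad s C : 'M[R]_m :=
  omega *m s *m omega *m C + omega *m C *m s *m omega.

Lemma symplectic_adj s : s^T = s -> (s *m omega)^T = - (omega *m s).
Proof. by move=> sS; rewrite trmx_mul sS omegaT mulNmx. Qed.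

(** The endomorphism [s omega] is skew-adjoint for [s] and invertible, so its square has negative
    trace. This function is later the denominator of the charts. *)
Lemma quad1_lt0 s : (0 < m)%N -> s^T = s -> posdef s -> quad 1%:M s < 0.
Proof.
move=> m0 symS posS; rewrite /quad mul1mx -mulmxA.
have [|le0 eq0] := @mxtrace_skewadjoint R m s (s *m omega) symS posS.
  by rewrite symplectic_adj // mulmxN opprK mulmxA.
rewrite lt_neqAle le0 andbT; apply/eqP => /eq0 e.
have : s *m omega \in unitmx by rewrite unitmx_mul omegaU posdef_unitmx.
rewrite e => /mulmxV; rewrite mul0mx => /matrixP /(_ (Ordinal m0) (Ordinal m0)) /eqP.
by rewrite !mxE eqxx eq_sym oner_eq0.
Qed.

(* Averaging B over the reference complex structure s0 omega yields an
   element of [traceless_hermitian s0], and B is skew-adjoint for s0 as soon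
   as this average vanishes. *)
Lemma quad_eq0_scalar (s0 s : 'M[R]_m) : (0 < m)%N ->
  s0^T = s0 -> posdef s0 -> s0 *m omega *m s0 *m omega = - 1%:M ->
  s^T = s -> posdef s -> (forall C, C \in traceless_hermitian s0 -> quad C s = 0) ->
  s *m omega *m s *m omega = (quad 1%:M s / m%:R)%:M.
Proof.
move=> m0 sym0 pos0 J0 symS posS quad0; set lam := _ / _.
(* The trace-free part of [(s omega)^2]; it is self-adjoint for [s] and for [omega]. *)
pose B := s *m omega *m s *m omega - lam%:M.
have BT : B^T = omega *m s *m omega *m s - lam%:M.
  rewrite /B linearB /= -mulmxA trmx_mul !symplectic_adj // tr_scalar_mx mulNmx mulmxN opprK.
  by rewrite !mulmxA.
have Bs : B *m s = s *m B^T.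
  by rewrite BT mulmxBl mulmxBr !mulmxA mul_scalar_mx mul_mx_scalar.
have oB : omega *m B = B^T *m omega.
  by rewrite BT mulmxBl mulmxBr !mulmxA mul_scalar_mx mul_mx_scalar.
have trB : \tr B = 0.
  rewrite /B linearB /= mxtrace_scalar -mulr_natr divfK ?pnatr_eq0 -?lt0n //.
  by rewrite /quad mul1mx subrr.
have J0' : omega *m s0 *m omega *m s0 = - 1%:M.
  apply: (can_inj (mulmxK omegaU)).
  by have := congr1 (mulmx omega) J0; rewrite mulmxN mulmx1 !mulmxA mulNmx mul1mx.
have J0r k (X : 'M[R]_(k, m)) : X *m s0 *m omega *m s0 *m omega = - X.
  by have := congr1 (mulmx X) J0; rewrite mulmxN mulmx1 !mulmxA.
have J0r' k (X : 'M[R]_(k, m)) : X *m omega *m s0 *m omega *m s0 = - X.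
  by have := congr1 (mulmx X) J0'; rewrite mulmxN mulmx1 !mulmxA.
(* With [j = s0 omega] one has [j^-1 = - j], so [C = B + j B j^-1] is twice the average of [B] over
   [j]. *)
pose C := B - s0 *m omega *m B *m s0 *m omega.
have CT : C^T = B^T - omega *m s0 *m omega *m B *m s0.
  have -> : C = B - s0 *m omega *m B *m (s0 *m omega) by rewrite !mulmxA.
  rewrite linearB /= trmx_mul [(_ *m B)^T]trmx_mul !symplectic_adj //.
  rewrite mulNmx !mulmxN opprK.
  by rewrite (mulmxA B^T) -oB !mulmxA.
have Cs0 : C *m s0 = B *m s0 + s0 *m B^T.
  rewrite mulmxBl -(mulmxA s0 omega B) oB !mulmxA.
  by rewrite J0r' opprK.
have s0C : s0 *m C^T = B *m s0 + s0 *m B^T.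
  by rewrite CT mulmxBr !mulmxA J0 !mulNmx mul1mx opprK addrC.
have CW : C \in traceless_hermitian s0.
  apply/traceless_hermitianP; split; first by rewrite Cs0 s0C.
    by rewrite CT mulmxBl /C mulmxBr oB !mulmxA.
  have -> : C = B - s0 *m omega *m B *m (s0 *m omega) by rewrite !mulmxA.
  rewrite linearB /= mxtrace_mulC !mulmxA J0 mulNmx mul1mx linearN /= trB.
  by rewrite oppr0 subrr.
(* [B] differs from [(s omega)^2] by a scalar matrix, which pairs to 0 with the trace-free [C]. *)
have trCB : \tr (C *m B) = 0.
  rewrite /B mulmxBr linearB /= -/(quad C s) quad0 // mul_mx_scalar linearZ /=.
  by case/traceless_hermitianP: CW => _ _ ->; rewrite mulr0 subrr.
have J0C : s0 *m omega *m C *m s0 *m omega = - C.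
  rewrite /C; move: (B) => X; rewrite mulmxBr !mulmxBl !mulmxA J0r J0.
  by rewrite !mulNmx mul1mx !opprK opprB.
(* Since [j C j = - C], the two terms of the second factor [C] contribute the same trace up to sign,
   and [trCB] kills both. *)
have trCC : \tr (C *m C) = 0.
  rewrite {2}/C mulmxBr linearB /= trCB.
  have -> : C *m (s0 *m omega *m B *m s0 *m omega) = (C *m s0 *m omega *m B) *m (s0 *m omega).
    by rewrite !mulmxA.
  by rewrite mxtrace_mulC !mulmxA J0C mulNmx linearN /= trCB oppr0 subrr.
have C0 : C = 0.
  case/traceless_hermitianP: CW => /(mxtrace_selfadjoint sym0 pos0)[_ eq0] _ _.
  exact: eq0.
have Bs0 : B *m s0 = - (s0 *m B^T).
  by apply/eqP; rewrite -addr_eq0 -Cs0 C0 mul0mx.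
have := selfadjoint_skewadjoint_eq0 symS posS sym0 pos0 Bs Bs0.
by move/subr0_eq.
Qed.

Lemma dual_quadE C s (v : 'M[R]_m) : \tr (dual_quad s C *m v) =
  \tr (C *m (v *m omega *m s *m omega + s *m omega *m v *m omega)).
Proof.
apply/esym; rewrite /dual_quad mulmxDl mulmxDr !linearD /=; congr (_ + _).
  by rewrite -!mulmxA mulmxA mxtrace_mulC !mulmxA.
by rewrite 3!mulmxA mxtrace_mulC !mulmxA.
Qed.

(** Cancelling [omega] on both sides of [dual_quad s C = 0] and using [omega C = C^T omega] gives
    [C s = - s C^T]: [C] is skew-adjoint for [s] while self-adjoint for [s0]. *)
Lemma dual_quad_inj (s0 C s : 'M[R]_m) : s0^T = s0 -> posdef s0 ->
  C *m s0 = s0 *m C^T -> omega *m C = C^T *m omega -> s^T = s -> posdef s ->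
  dual_quad s C = 0 -> C = 0.
Proof.
move=> sym0 pos0 Cs0 oC symS posS; rewrite /dual_quad => e.
apply: (selfadjoint_skewadjoint_eq0 sym0 pos0 symS posS Cs0).
apply: (can_inj (mulmxK omegaU)); apply: (can_inj (mulKmx omegaU)).
rewrite mulNmx -(mulmxA s) -oC mulmxN; apply/eqP; rewrite -addr_eq0 addrC.
by rewrite !mulmxA e.
Qed.

End HermitianEndomorphisms.

(** * Lagrangian frames and the use of regularity *)

Section LagrangianFrames.
Variables (R : realType) (m : nat) (omega : 'M[R]_m).
Hypotheses (omegaT : omega^T = - omega) (omegaU : omega \in unitmx).
Implicit Types (s C q p : 'M[R]_m) (L : {vspace 'cV[R]_m}).

(** Gram-Schmidt: if [K K^T] is the Gram matrix of a basis [B0] of [L], then [B0 K^-T] is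
    orthonormal. *)
Lemma orthonormal_basis (g : 'M[R]_m) L : g^T = g -> posdef g ->
  exists2 B : 'M[R]_(m, \dim L), B^T *m g *m B = 1%:M & forall u, B *m u \in L.
Proof.
move=> symg posg.
pose B0 : 'M[R]_(m, \dim L) := \matrix_(i, j) (vbasis L)`_j i 0.
have B0E (u : 'cV_(\dim L)) : B0 *m u = \sum_j u j 0 *: (vbasis L)`_j.
  apply/matrixP => i k; rewrite !mxE summxE ord1; apply: eq_bigr => j _.
  by rewrite !mxE mulrC.
have B0L (u : 'cV_(\dim L)) : B0 *m u \in L.
  rewrite B0E; apply: memv_suml => j _; apply/memvZ/vbasis_mem/mem_nth.
  by rewrite size_tuple.
have B0inj (u : 'cV_(\dim L)) : B0 *m u = 0 -> u = 0.
  rewrite B0E => e; apply/matrixP => j k; rewrite ord1 mxE.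
  by have /freeP /(_ (fun j => u j 0) e j) := basis_free (vbasisP L).
have symG : (B0^T *m g *m B0)^T = B0^T *m g *m B0.
  by rewrite !trmx_mul trmxK symg mulmxA.
have posG : posdef (B0^T *m g *m B0).
  move=> u u0; rewrite bilin_mul; apply: posg; apply: contra u0 => /eqP.
  by move/B0inj => ->.
have [K Ku eK] := cholesky symG posG.
exists (B0 *m (invmx K)^T) => [|u]; last by rewrite -mulmxA.
rewrite trmx_mul trmxK.
have -> : invmx K *m B0^T *m g *m (B0 *m (invmx K)^T) =
   invmx K *m (B0^T *m g *m B0) *m (invmx K)^T by rewrite !mulmxA.
by rewrite eK mulKmx // -trmx_mul mulVmx // trmx1.
Qed.

(* With B an s^-1-orthonormal basis of L, the columns of B and of
   lam^(-1/2) J B (where J = s omega) form an s^-1-orthonormal basis of V. *)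
Lemma lagrangian_trace_gt0 s q L lam : (0 < m)%N ->
  s^T = s -> posdef s -> s *m omega *m s *m omega = - lam%:M -> 0 < lam ->
  omega *m s *m q = q *m s *m omega -> is_lagrangian omega L ->
  (forall u, u \in L -> u != 0 -> 0 < bilin q u u) -> 0 < \tr (q *m s).
Proof.
move=> m0 symS posS J lam0 qJ [dimL isoL] posL.
have sU := posdef_unitmx posS.
have symg : (invmx s)^T = invmx s by rewrite trmx_inv symS.
have [B BB BL] := orthonormal_basis L symg (posdef_invmx symS posS).
(* Isotropy of [L]; it makes the off-diagonal blocks of [TT] vanish, so [L] and [J L] are
   orthogonal. *)
have BoB : B^T *m omega *m B = 0.
  apply/matrixP => i j; rewrite mxE.
  have := isoL _ _ (BL (delta_mx i 0)) (BL (delta_mx j 0)).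
  by rewrite -bilin_mul /bilin !trmx_delta -!rowE -!colE !mxE.
have oso : omega *m s *m omega = - (lam *: invmx s).
  apply: (can_inj (mulKmx sU)); rewrite !mulmxA J mulmxN -scalemxAr mulmxV //.
  by rewrite scalemx1.
pose a := (Num.sqrt lam)^-1; pose T := row_mx B (a *: (s *m omega *m B)).
have aa : a * a * lam = 1.
  by rewrite -expr2 exprVn sqr_sqrtr ?ltW // mulVf ?gt_eqF.
have aT : (a *: (s *m omega *m B))^T = a *: (s *m omega *m B)^T by rewrite linearZ.
have TT : (T^T *m invmx s) *m T = 1%:M.
  rewrite tr_row_mx mul_col_mx mul_col_row BB.
  rewrite aT -!scalemxAr -!scalemxAl !scalerA.
  have -> : B^T *m invmx s *m (s *m omega *m B) = 0.
    by rewrite !mulmxA mulmxKV // BoB.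
  have -> : (s *m omega *m B)^T *m invmx s = - (B^T *m omega).
    by rewrite trmx_mul symplectic_adj // mulmxN mulNmx !mulmxA mulmxK.
  rewrite !mulNmx BoB oppr0 !scaler0.
  have -> : B^T *m omega *m (s *m omega *m B) = - lam%:M.
    have -> : B^T *m omega *m (s *m omega *m B) = B^T *m (omega *m s *m omega) *m B.
      by rewrite !mulmxA.
    by rewrite oso mulmxN mulNmx -scalemxAr -scalemxAl BB scalemx1.
  by rewrite opprK scale_scalar_mx aa -scalar_mx_block.
have dimLm : (\dim L + \dim L = m)%N by rewrite addnn -muln2.
have eS : s = T *m T^T.
  have := mulmx1_flip dimLm TT; rewrite mulmxA => e.
  by rewrite -[LHS]mul1mx -e mulmxKV.
have JqJ : (s *m omega)^T *m q *m (s *m omega) = lam *: q.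
  rewrite symplectic_adj // !mulNmx qJ mulmxA.
  have -> : q *m s *m omega *m s *m omega = q *m (s *m omega *m s *m omega).
    by rewrite !mulmxA.
  by rewrite J mulmxN opprK mul_mx_scalar.
(* In the frame [T] the trace splits into the parts over [L] and [J L], which are equal by [JqJ]. *)
have -> : \tr (q *m s) = 2 * \tr (B^T *m q *m B).
  rewrite eS mulmxA mxtrace_mulC mulmxA tr_row_mx mul_col_mx mul_col_row mxtrace_block.
  rewrite aT trmx_mul -!scalemxAr -!scalemxAl !scalerA linearZ /=.
  have -> : B^T *m (s *m omega)^T *m q *m (s *m omega *m B) =
    B^T *m ((s *m omega)^T *m q *m (s *m omega)) *m B by rewrite !mulmxA.
  rewrite JqJ -scalemxAr -scalemxAl linearZ /= mulrA aa; ring.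
rewrite pmulr_rgt0 // /mxtrace.
have qB i : 0 < (B^T *m q *m B) i i.
  have -> : (B^T *m q *m B) i i = bilin q (B *m delta_mx i 0) (B *m delta_mx i 0).
    by rewrite -bilin_mul /bilin trmx_delta -rowE -colE !mxE.
  apply: posL => //; apply/eqP => Bi.
  have := congr1 (fun X => (X *m delta_mx i 0 : 'cV_ _) i 0) BB.
  rewrite -mulmxA Bi mulmx0 mul1mx !mxE !eqxx => /esym/eqP.
  by rewrite oner_eq0.
have i0 : 'I_(\dim L).
  by exists 0%N; rewrite -(ltn_pmul2r (isT : 0 < 2)%N) mul0n dimL.
rewrite (bigD1 i0) //= ltr_wpDr // sumr_ge0 // => i _; exact: ltW.
Qed.

(** As [(s omega)^2] is scalar, [q = - dual_quad s C] satisfies [omega s q = q s omega]. If [q] were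
    nonzero, a Lagrangian on which it is positive would force [tr (q s) > 0]. Once [q = 0],
    [dual_quad_inj] applies. *)
Lemma regular_dual_quad_inj (s0 C s q : 'M[R]_m) lam : (0 < m)%N ->
  s0^T = s0 -> posdef s0 -> C *m s0 = s0 *m C^T -> omega *m C = C^T *m omega ->
  s^T = s -> posdef s -> s *m omega *m s *m omega = - lam%:M -> 0 < lam ->
  (q != 0 -> omega_regular omega q) -> \tr (q *m s) = 0 ->
  dual_quad omega s C + q = 0 -> q = 0 /\ C = 0.
Proof.
move=> m0 sym0 pos0 Cs0 oC symS posS J lam0 regq tr0 e.
have q0 : q = 0.
  apply: contra_eq tr0 => /regq [Lp [_ [lagL _ posL _]]].
  rewrite gt_eqF // (lagrangian_trace_gt0 m0 symS posS J lam0 _ lagL) //.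
  have -> : q = - dual_quad omega s C by apply/eqP; rewrite -addr_eq0 addrC e.
  rewrite mulmxN !mulNmx mulmxDr !mulmxDl !mulmxA; congr (- _).
  have -> : omega *m s *m omega *m s *m omega *m C = - (lam *: (omega *m C)).
    have -> : omega *m s *m omega *m s *m omega *m C = omega *m (s *m omega *m s *m omega) *m C.
      by rewrite !mulmxA.
    by rewrite J mulmxN mulNmx mul_mx_scalar scalemxAl.
  have -> : omega *m C *m s *m omega *m s *m omega = - (lam *: (omega *m C)).
    have -> : omega *m C *m s *m omega *m s *m omega = omega *m C *m (s *m omega *m s *m omega).
      by rewrite !mulmxA.
    by rewrite J mulmxN mul_mx_scalar.
  by rewrite addrC.
split=> //; apply: (dual_quad_inj omegaU sym0 pos0 Cs0 oC symS posS).
by move: e; rewrite q0 addr0.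
Qed.

End LagrangianFrames.

(** * Directional derivatives computed along lines *)

Section DirectionalDerivatives.
Variables (R : realType) (V W : normedModType R).
Implicit Types (f g : V -> W) (x v : V).

(** The derivative along [v] depends only on values on the line near [x], so it can be transferred
    between functions that agree merely on a relatively open subset of a linear subspace. *)
Lemma line_eq_is_derive f g x v df : (\forall h \near (0 : R), f (h *: v + x) = g (h *: v + x)) ->
  is_derive x v f df -> is_derive x v g df.
Proof.
move=> fg; have fgx : f x = g x by have := nbhs_singleton fg; rewrite scale0r add0r.
have e : \forall h \near (0 : R)^',
    h^-1 *: (f (h *: v + x) - f x) = h^-1 *: (g (h *: v + x) - g x).
  by apply: cvg_within; near=> h; rewrite fgx (near fg h).
move=> [/cvg_ex[/= l fl] dfE].
have ldf : l = df by rewrite -dfE; apply/esym/cvg_lim.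
have gl : h^-1 *: (g (h *: v + x) - g x) @[h --> (0 : R)^'] --> l.
  exact: cvg_trans (near_eq_cvg e) fl.
by split; [apply/cvg_ex; exists l | rewrite -ldf; apply/cvg_lim].
Unshelve. all: by end_near. Qed.

(** For functions at most quadratic along each line, such as [quad] and traces, the derivative is
    the linear coefficient. *)
Lemma expansion_is_derive (f : V -> R) x v (a b : R) :
  (forall h : R, f (h *: v + x) = f x + h * a + h ^+ 2 * b) -> is_derive x v f a.
Proof.
move=> fE.
have fa : h^-1 *: (f (h *: v + x) - f x) @[h --> (0 : R)^'] --> a.
  have e : \forall h \near (0 : R)^', a + h * b = h^-1 *: (f (h *: v + x) - f x).
    near=> h; have h0 : h != 0 by near: h; exact: nbhs_dnbhs_neq.
    by rewrite fE /GRing.scale /=; field.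
  apply: cvg_trans (near_eq_cvg e) _; apply: cvg_within_filter.
  have : a + h * b @[h --> (0 : R)] --> a + 0 * b.
    by apply: cvgD; [exact: cvg_cst | apply: cvgM; [exact: cvg_id | exact: cvg_cst]].
  by rewrite mul0r addr0.
by split; [apply/cvg_ex; exists a | apply/cvg_lim].
Unshelve. all: by end_near. Qed.

End DirectionalDerivatives.

(** * Calculus of C^k functions on relatively open sets *)

Section SmoothFunctions.
Variables (R : realType) (V : normedModType R) (E D : set V).
(** Relative openness of [D] in [E], in the form used by directional derivatives. *)
Hypothesis DE : forall x v, D x -> E v -> \forall h \near (0 : R), D (h *: v + x).

Lemma is_Ck_eq (W : normedModType R) k (f g : V -> W) :
  (forall x, D x -> f x = g x) -> is_Ck k E D f -> is_Ck k E D g.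
Proof.
elim: k f g => [|k IH] f g fg [fc fd]; (split; last first) => //.
- by apply: subspace_eq_continuous fc => x; rewrite inE => /fg.
- move=> v Ev; have [fdv fk] := fd v Ev.
  have gd x : D x -> is_derive x v g ('D_v f x).
    move=> Dx; apply: (@line_eq_is_derive _ _ _ f); last exact/derivableP/fdv.
    by have := DE Dx Ev; apply: filterS => h /fg.
  split=> [x /gd [] //|]; apply: IH fk => x Dx; apply/esym.
  exact: (@derive_val _ _ _ _ _ _ _ (gd x Dx)).
- by apply: subspace_eq_continuous fc => x; rewrite inE => /fg.
Qed.

(** Introduction rule: the derivative may be given by a formula [df] that is correct only on [D],
    whatever the value of ['D_v f] elsewhere. *)
Lemma is_CkS (W : normedModType R) k (f : V -> W) :
  {within D, continuous f} ->
  (forall v, E v -> exists2 df, forall x, D x -> is_derive x v f (df x) & is_Ck k E D df) ->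
  is_Ck k.+1 E D f.
Proof.
move=> fc fd; split=> // v /fd [df fdf dfk]; split=> [x /fdf []//|].
apply: is_Ck_eq dfk => x Dx; apply/esym; exact: (@derive_val _ _ _ _ _ _ _ (fdf x Dx)).
Qed.

Lemma is_CkW (W : normedModType R) k (f : V -> W) : is_Ck k.+1 E D f -> is_Ck k E D f.
Proof.
elim: k f => [|k IH] f; first by case.
by move=> [fc fd]; split=> // v /fd [fdv /IH].
Qed.

Lemma is_Ck_derive (W : normedModType R) k (f : V -> W) v : is_Ck k.+1 E D f -> E v ->
  (forall x, D x -> is_derive x v f ('D_v f x)) /\ is_Ck k E D ('D_v f).
Proof. by move=> [_ /[apply]] [fd fk]; split=> // x /fd /derivableP. Qed.

Lemma is_Ck_cst (W : normedModType R) k (c : W) : is_Ck k E D (fun=> c).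
Proof.
elim: k c => [|k IH] c; first by split=> // x; exact: cvg_cst.
apply: is_CkS => [x|v _]; first exact: cvg_cst.
by exists (fun=> 0) => // x _; exact: is_derive_cst.
Qed.

Lemma is_CkD (W : normedModType R) k (f g : V -> W) :
  is_Ck k E D f -> is_Ck k E D g -> is_Ck k E D (fun x => f x + g x).
Proof.
elim: k f g => [|k IH] f g Cf Cg.
  split=> // x; apply: cvgD; [exact: Cf.1 | exact: Cg.1].
apply: is_CkS => [x|v Ev]; first by apply: cvgD; [exact: Cf.1 | exact: Cg.1].
have [df Cdf] := is_Ck_derive Cf Ev; have [dg Cdg] := is_Ck_derive Cg Ev.
exists (fun x => 'D_v f x + 'D_v g x); last exact: IH.
move=> x Dx; have := dg x Dx; have := df x Dx; exact: is_deriveD.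
Qed.

Lemma is_CkM k (f g : V -> R) :
  is_Ck k E D f -> is_Ck k E D g -> is_Ck k E D (fun x => f x * g x).
Proof.
elim: k f g => [|k IH] f g Cf Cg.
  split=> // x; apply: cvgM; [exact: Cf.1 | exact: Cg.1].
apply: is_CkS => [x|v Ev]; first by apply: cvgM; [exact: Cf.1 | exact: Cg.1].
have [df Cdf] := is_Ck_derive Cf Ev; have [dg Cdg] := is_Ck_derive Cg Ev.
exists (fun x => f x * 'D_v g x + g x * 'D_v f x).
  by move=> x Dx; have := dg x Dx; have := df x Dx; exact: is_deriveM.
by apply: is_CkD; apply: IH => //; exact: is_CkW.
Qed.

Lemma is_CkV k (f : V -> R) : (forall x, D x -> f x != 0) ->
  is_Ck k E D f -> is_Ck k E D (fun x => (f x)^-1).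
Proof.
move=> f0; have Vc : is_Ck 0 E D f -> {within D, continuous (fun x => (f x)^-1)}.
  move=> [/subspace_continuousP fc _]; apply/subspace_continuousP => x Dx.
  by apply: cvgV; [exact: f0 | exact: fc].
elim: k => [|k IH] Cf; first by split=> //; exact: Vc.
apply: is_CkS => [|v Ev]; first by apply: Vc; split=> //; exact: Cf.1.
have [df Cdf] := is_Ck_derive Cf Ev.
exists (fun x => -1 * ((f x)^-1 * (f x)^-1) * 'D_v f x).
  move=> x Dx; have [fd _] := df x Dx; split; first exact: derivableV (f0 x Dx) fd.
  rewrite deriveV ?f0 // /GRing.scale /=; congr (_ * _).
  by rewrite mulN1r expr2 invfM.
have CV := IH (is_CkW Cf).
apply: is_CkM => //; apply: is_CkM; [exact: is_Ck_cst | exact: is_CkM].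
Qed.

Lemma is_Ck_sum (W : normedModType R) k I (r : seq I) (P : pred I) (F : I -> V -> W) :
  (forall i, P i -> is_Ck k E D (F i)) -> is_Ck k E D (fun x => \sum_(i <- r | P i) F i x).
Proof.
move=> CF; elim: r => [|i r IH].
  by apply: (is_Ck_eq _ (is_Ck_cst k 0)) => x _; rewrite big_nil.
case: (boolP (P i)) => Pi.
  by apply: (is_Ck_eq _ (is_CkD (CF i Pi) IH)) => x _; rewrite big_cons Pi.
by apply: (is_Ck_eq _ IH) => x _; rewrite big_cons (negbTE Pi).
Qed.

Lemma is_Ck_prod k I (r : seq I) (F : I -> V -> R) :
  (forall i, is_Ck k E D (F i)) -> is_Ck k E D (fun x => \prod_(i <- r) F i x).
Proof.
move=> CF; elim: r => [|i r IH].
  by apply: (@is_Ck_eq R _ (fun=> 1)) (is_Ck_cst _ _) => x _; rewrite big_nil.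
by apply: (@is_Ck_eq R) (is_CkM (CF i) IH) => x _; rewrite big_cons.
Qed.

Lemma is_Ck_det k a (f : V -> 'M[R]_a) :
  (forall i j, is_Ck k E D (fun x => f x i j)) -> is_Ck k E D (fun x => \det (f x)).
Proof.
move=> Cf; apply: is_Ck_sum => sigma _.
by apply: is_CkM; [exact: is_Ck_cst | apply: is_Ck_prod].
Qed.

Lemma is_Ck_mulmx k a b c (f : V -> 'M[R]_(a, b)) (g : V -> 'M[R]_(b, c)) :
  (forall i j, is_Ck k E D (fun x => f x i j)) ->
  (forall i j, is_Ck k E D (fun x => g x i j)) ->
  forall i j, is_Ck k E D (fun x => (f x *m g x) i j).
Proof.
move=> Cf Cg i j; apply: (@is_Ck_eq _ _ (fun x => \sum_l f x i l * g x l j)) => [x _|].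
  by rewrite mxE.
by apply: is_Ck_sum => l _; exact: is_CkM (Cf i l) (Cg l j).
Qed.

Lemma is_Ck_mxtrace k a (f : V -> 'M[R]_a) :
  (forall i j, is_Ck k E D (fun x => f x i j)) -> is_Ck k E D (fun x => \tr (f x)).
Proof. by move=> Cf; apply: is_Ck_sum. Qed.

Lemma is_Ck_mx k a b (f : V -> 'M[R]_(a, b)) :
  (forall i j, is_Ck k E D (fun x => f x i j)) -> is_Ck k E D f.
Proof.
have fc (g : V -> 'M[R]_(a, b)) : (forall i j, is_Ck 0 E D (fun x => g x i j)) ->
    {within D, continuous g}.
  move=> Cg; apply/subspace_continuousP => x Dx.
  apply/cvgrPdist_le => e e0; near=> y.
  rewrite /Num.Def.normr /= mx_normrE (bigmax_le _ (ltW e0)) //= => i _.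
  rewrite !mxE; move: i; near: y; apply: filter_forall => /= i.
  by have /subspace_continuousP /(_ x Dx) /cvgrPdist_le /(_ e e0) := (Cg i.1 i.2).1.
elim: k f => [|k IH] f Cf; first by split=> //; exact: fc.
apply: is_CkS => [|v Ev]; first by apply: fc => i j; split=> //; exact: (Cf i j).1.
have df i j := is_Ck_derive (Cf i j) Ev.
exists (fun x => \matrix_(i, j) 'D_v (fun y => f y i j) x) => [x Dx|].
  have fd : derivable f x v by apply/derivable_mxP => i j; case: ((df i j).1 x Dx).
  by split=> //; exact: derive_mx.
apply: IH => i j; apply: is_Ck_eq (df i j).2 => x _; by rewrite mxE.
Unshelve. all: by end_near. Qed.

End SmoothFunctions.

Lemma is_Ck_coord (R : realType) a b (E D : set 'M[R]_(a, b)) k i j :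
  (forall x v, D x -> E v -> \forall h \near (0 : R), D (h *: v + x)) ->
  is_Ck k E D (fun s => s i j).
Proof.
move=> DE; have cc : {within D, continuous (fun s : 'M[R]_(a, b) => s i j)}.
  apply: continuous_subspaceT; exact: coord_continuous.
case: k => [|k]; first by split.
apply: is_CkS => // v _; exists (fun=> v i j); last exact: is_Ck_cst.
by move=> x _; apply: (@expansion_is_derive _ _ _ _ _ _ 0) => h; rewrite !mxE; ring.
Qed.

(** * The trace pairing on symmetric matrices, lines and projective open sets *)

Section SymmetricDuality.
Variables (R : realType) (m : nat).
Local Notation E := (@symmetric_mx R m).

(* The Gram matrix of the A i is positive definite. *)
Lemma trace_dual_surjective c (A : 'I_c -> 'M[R]_m) : (forall i, (A i)^T = A i) ->
  (forall a : 'I_c -> R, \sum_i a i *: A i = 0 -> forall i, a i = 0) ->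
  forall w : 'I_c -> R, exists2 v, E v & forall i, \tr (A i *m v) = w i.
Proof.
move=> symA freeA w.
pose G : 'M[R]_c := \matrix_(i, j) \tr (A i *m A j).
have trA (i : 'I_c) (x : 'cV[R]_c) : \tr (A i *m \sum_j x j 0 *: A j) = (G *m x) i 0.
  rewrite mulmx_sumr raddf_sum mxE; apply: eq_bigr => j _.
  by rewrite /= -scalemxAr mxtraceZ mxE mulrC.
have symS (x : 'cV[R]_c) : E (\sum_j x j 0 *: A j).
  by rewrite /symmetric_mx /= raddf_sum; apply: eq_bigr => j _; rewrite /= linearZ /= symA.
have Gpos : posdef G.
  move=> x x0; have -> : bilin G x x = \tr ((\sum_j x j 0 *: A j)^T *m (\sum_j x j 0 *: A j)).
    rewrite symS mulmx_suml raddf_sum /bilin -mulmxA mxE; apply: eq_bigr => i _.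
    by rewrite /= -scalemxAl mxtraceZ trA !mxE.
  rewrite lt_neqAle mxtrace_gram_ge0 andbT eq_sym; apply: contra x0 => /eqP.
  move/mxtrace_gram_eq0/freeA => x0; apply/eqP/matrixP => i j; by rewrite ord1 x0 mxE.
exists (\sum_j (invmx G *m \col_i w i) j 0 *: A j); first exact: symS.
by move=> i; rewrite trA mulKVmx ?posdef_unitmx // mxE.
Qed.

Lemma symmetric_combine a (s v : 'M[R]_m) : E s -> E v -> E (a *: v + s).
Proof. by rewrite /symmetric_mx /= => es ev; rewrite linearP /= es ev. Qed.

Lemma symmetricZ a (s : 'M[R]_m) : E s -> E (a *: s).
Proof. by rewrite /symmetric_mx /= => es; rewrite linearZ /= es. Qed.

(** Supplies the hypothesis [DE] of the C^k calculus for lifts of projective open sets. *)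
Lemma proj_open_line (U : set {vspace 'M[R]_m}) : Defs.proj_open E U ->
  forall x v, proj_lift E U x -> E v -> \forall h \near (0 : R), proj_lift E U (h *: v + x).
Proof.
move=> [_ [Om oOm ->]] x v [Ex Ox] Ev; near=> h; split; first exact: symmetric_combine.
near: h; have hO : nbhs (0 *: v + x) Om by rewrite scale0r add0r; exact: open_nbhs_nbhs.
have : h *: v + x @[h --> (0 : R)] --> 0 *: v + x.
  by apply: cvgD; [apply: cvgZl; exact: cvg_id | exact: cvg_cst].
exact.
Unshelve. all: by end_near. Qed.

Lemma line_scale (c : R) (s : 'M[R]_m) : c != 0 -> <[c *: s]>%VS = <[s]>%VS.
Proof.
move=> c0; apply/eqP; rewrite eqEsubv -!memvE; apply/andP; split.
  exact/memvZ/memv_line.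
by rewrite -[X in X \in _](scalerK c0) memvZ ?memv_line.
Qed.

Lemma line_eq (s t : 'M[R]_m) : s != 0 -> <[s]>%VS = <[t]>%VS ->
  exists2 c : R, c != 0 & s = c *: t.
Proof.
move=> s0 e; have : s \in <[t]>%VS by rewrite -e memv_line.
move=> /vlineP [c sc]; exists c => //; apply: contra s0 => /eqP c0.
by rewrite sc c0 scale0r.
Qed.

(** Functions of a line are defined below through its representative [vpick]; this lets degree-0
    homogeneous expressions be evaluated at any other spanning vector. *)
Lemma vpick_line (s : 'M[R]_m) : exists2 c : R, c != 0 & vpick <[s]>%VS = c *: s.
Proof.
have [->|s0] := eqVneq s 0.
  by exists 1; rewrite ?oner_eq0 // scaler0; apply/eqP; rewrite vpick0 -subv0 -memvE memv0.
have /vlineP[c e] := memv_pick <[s]>%VS; exists c => //; apply: contraNneq s0 => c0.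
have /eqP : vpick <[s]>%VS = 0 by rewrite e c0 scale0r.
by rewrite vpick0 => /eqP s0; rewrite -memv0 -s0 memv_line.
Qed.

Lemma is_Ck_sub (V W : normedModType R) k (F D D' : set V) (f : V -> W) :
  D' `<=` D -> is_Ck k F D f -> is_Ck k F D' f.
Proof.
move=> DD; elim: k f => [|k IH] f [fc fd]; split => //; try exact: continuous_subspaceW fc.
by move=> v Fv; have [fdv /IH] := fd v Fv; split=> // x /DD; exact: fdv.
Qed.

(** * Submersions from linearly independent gradients *)

Section Submersion.
Variables (c : nat) (U : set {vspace 'M[R]_m}) (phi : 'I_c -> {vspace 'M[R]_m} -> R).
(** [A i s] is the gradient of the i-th equation; it scales with degree -1 because the equation is
    constant on each punctured line. *)
Variable A : 'I_c -> 'M[R]_m -> 'M[R]_m.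
Hypothesis Uopen : Defs.proj_open E U.
Hypothesis phi_smooth : forall i, is_smooth E (proj_lift E U) (fun s => phi i <[s]>%VS).
Hypothesis phi_derive : forall i s v, proj_lift E U s -> E v ->
  is_derive s v (fun s => phi i <[s]>%VS) (\tr (A i s *m v)).
Hypothesis A_sym : forall i s, E s -> (A i s)^T = A i s.
Hypothesis A_homog : forall i a s, a != 0 -> A i (a *: s) = a^-1 *: A i s.

Let indep s := forall a : 'I_c -> R, \sum_i a i *: A i s = 0 -> forall i, a i = 0.

Lemma is_submersion_indep :
  (forall s, proj_lift E U s -> indep s) -> is_submersion E U phi.
Proof.
move=> ind; split=> // s Us w.
have [Es _ _] := Us.
have [v Ev vw] := trace_dual_surjective (fun i => A_sym i Es) (ind s Us) w.
exists v => // i; rewrite -vw; exact: (@derive_val _ _ _ _ _ _ _ (phi_derive i Us Ev)).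
Qed.

(** Independence at one point persists nearby: the Jacobian determinant [delta] along fixed
    directions [v j], dual to the gradients at [s0], is continuous, equals 1 at [s0], and by
    homogeneity its nonvanishing depends only on the line. *)
Lemma shrink_submersion s0 : proj_lift E U s0 -> indep s0 ->
  exists U', [/\ U' `<=` U, Defs.proj_open E U', U' <[s0]>%VS & is_submersion E U' phi].
Proof.
move=> Us0 ind0; have [Es0 s00 _] := Us0.
have /choice [v vP] j : exists v, E v /\ forall i, \tr (A i s0 *m v) = (i == j)%:R.
  have [v] := trace_dual_surjective (fun i => A_sym i Es0) ind0 (fun i => (i == j)%:R).
  by exists v.
pose M s : 'M[R]_c := \matrix_(i, j) \tr (A i s *m v j).
pose delta s := \det (M s).
have delta0 : delta s0 = 1.
  rewrite /delta (_ : M s0 = 1%:M) ?det1 //; apply/matrixP => i j.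
  by rewrite !mxE (vP j).2.
have deltaZ a s : a != 0 -> (delta (a *: s) == 0) = (delta s == 0).
  move=> a0; have -> : delta (a *: s) = a^-1 ^+ c * delta s.
    rewrite /delta -detZ; congr (\det _); apply/matrixP => i j.
    by rewrite !mxE A_homog // -scalemxAl mxtraceZ.
  by rewrite mulf_eq0 expf_eq0 invr_eq0 (negbTE a0) andbF.
have delta_cont : {within proj_lift E U, continuous delta}.
  have entry i j : {within proj_lift E U, continuous (fun s => M s i j)}.
    (* The entry is the derivative of the i-th equation along [v j], hence continuous by C^1
       regularity. *)
    have [_ /(_ (v j) (vP j).1)[_ [fc _]]] := phi_smooth i 1.
    apply: subspace_eq_continuous fc => s; rewrite inE => Us.
    rewrite /M /from_subspace mxE.
    exact: (@derive_val _ _ _ _ _ _ _ (phi_derive i Us (vP j).1)).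
  have Cdelta : is_Ck 0 E (proj_lift E U) delta.
    by apply: is_Ck_det => [|i j]; [exact: proj_open_line | split=> //; exact: entry].
  exact: Cdelta.1.
pose U' := [set l | U l /\ delta (vpick l) != 0].
have liftU' s : proj_lift E U' s <-> proj_lift E U s /\ delta s != 0.
  have [a a0 es] := vpick_line s.
  split=> [[Es sn0 [Us ds]]|[[Es sn0 Us] ds]]; split=> //.
    by move: ds; rewrite /= es deltaZ.
  by split=> //=; rewrite es deltaZ.
exists U'; split; first by move=> l [].
- split; first by move=> l [Ul _]; exact: Uopen.1.
  have [_ [Om oOm eOm]] := Uopen.
  have /open_subspaceP [N oN eN] :
      open (delta @^-1` [set x : R | x != 0] : set (subspace (proj_lift E U))).
    by move/continuousP: delta_cont; apply; exact: open_neq.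
  exists (Om `&` N); first exact: openI.
  rewrite setIA -eOm; apply/seteqP; split=> s.
    move=> /liftU'[Us ds]; split=> //.
    by have [] : (N `&` proj_lift E U) s by rewrite eN.
  move=> [Us Ns]; apply/liftU'; split=> //.
  by have [] : (delta @^-1` [set x : R | x != 0] `&` proj_lift E U) s by rewrite -eN.
- by have /liftU'[] : proj_lift E U s0 /\ delta s0 != 0 by rewrite delta0 oner_eq0.
- split=> [i k|s /liftU'[Us ds] w].
    by apply: is_Ck_sub (phi_smooth i k) => s /liftU'[].
  have [Es _ _] := Us.
  (* Where [delta] is nonzero, the system for the coefficients along the [v j] is solved by
     inverting [M s]. *)
  exists (\sum_j (invmx (M s) *m \col_i w i) j 0 *: v j).
    rewrite /symmetric_mx /= raddf_sum; apply: eq_bigr => j _.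
    by rewrite /= linearZ /= (vP j).1.
  move=> i; rewrite (@derive_val _ _ _ _ _ _ _ (phi_derive i Us _)).
    rewrite mulmx_sumr raddf_sum.
    transitivity ((M s *m (invmx (M s) *m \col_i w i)) i 0).
      rewrite mxE; apply: eq_bigr => j _.
      by rewrite /= -scalemxAr mxtraceZ mulrC [M s i j]mxE.
    by rewrite mulKVmx ?mxE // unitmxE unitfE.
  rewrite /symmetric_mx /= raddf_sum; apply: eq_bigr => j _.
  by rewrite /= linearZ /= (vP j).1.
Qed.
End Submersion.
End SymmetricDuality.

(** * Openness of positive definiteness *)

Section DefiniteLines.
Variables (R : realType) (m : nat).
Local Notation E := (@symmetric_mx R m).

(** By [|u_i u_j| <= (u_i^2 + u_j^2) / 2] the perturbation is at most [m / (m + 1)] times the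
    squared norm of [u], which is strictly less than that norm squared. *)
Lemma near1_posdef (e : 'M[R]_m) :
  (forall i j, `|(e - 1%:M) i j| < m.+1%:R^-1) -> posdef e.
Proof.
move=> eE u u0; have -> : e = 1%:M + (e - 1%:M) by rewrite addrC subrK.
rewrite bilinD bilin1; set N := \sum_i _; set d := e - 1%:M.
have N0 : 0 < N.
  rewrite lt_neqAle sumr_ge0 ?andbT => [|i _]; last exact: sqr_ge0.
  rewrite eq_sym; apply: contra u0 => /eqP N0; apply/eqP/matrixP => i j; rewrite ord1 mxE.
  have /eqP := psumr_eq0P (fun i _ => sqr_ge0 (u i 0)) N0 (i := i) isT.
  by rewrite sqrf_eq0 => /eqP.
have key : - bilin d u u <= m%:R * m.+1%:R^-1 * N.
  rewrite -[leLHS]mulN1r /bilin mxE mulr_sumr.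
  have step j : -1 * ((u^T *m d) 0 j * u j 0) <=
     \sum_i m.+1%:R^-1 * (u i 0 ^+ 2 / 2 + u j 0 ^+ 2 / 2).
    rewrite mxE mulr_suml mulr_sumr; apply: ler_sum => i _; rewrite mxE mulN1r.
    apply: le_trans (ler_norm _) _; rewrite normrN !normrM.
    have h1 := eE i j; rewrite -/d in h1.
    have -> : `|u i 0| * `|d i j| * `|u j 0| = `|d i j| * (`|u i 0| * `|u j 0|) by ring.
    apply: ler_pM; [exact: normr_ge0 | exact: mulr_ge0 | exact: ltW |].
    rewrite -(real_normK (num_real (u i 0))) -(real_normK (num_real (u j 0))).
    have := sqr_ge0 (`|u i 0| - `|u j 0|); nra.
  apply: le_trans (ler_sum _ (fun j _ => step j)) _.
  rewrite (eq_bigr (fun j => m.+1%:R^-1 * N / 2 + (m%:R * m.+1%:R^-1 / 2) * u j 0 ^+ 2)).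
    rewrite big_split /= sumr_const card_ord -mulr_sumr -/N -mulr_natl.
    by rewrite le_eqVlt; apply/orP; left; apply/eqP; move: (_^-1) => r; field.
  move=> j _; rewrite -mulr_sumr big_split /= sumr_const card_ord -mulr_suml -/N -mulr_natl.
  by move: (_^-1) => r; field.
have m1 : m%:R * m.+1%:R^-1 < 1 :> R by rewrite ltr_pdivrMr ?ltr0n // mul1r ltr_nat.
have mN : m%:R * m.+1%:R^-1 * N < N by rewrite gtr_pMl.
by have := le_lt_trans key mN; rewrite -subr_gt0 opprK.
Qed.

(** A Cholesky factor of [s] conjugates the question to a neighbourhood of the identity. *)
Lemma posdef_open (s : 'M[R]_m) : s^T = s -> posdef s ->
  exists2 O : set 'M[R]_m, open O & O s /\ forall A, O A -> posdef A.
Proof.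
move=> symS /cholesky [//|C Cu eC].
have CtU : C^T \in unitmx by rewrite unitmx_tr.
pose f (A : 'M[R]_m) := invmx C *m A *m (invmx C)^T.
have fc i j : continuous (fun A => f A i j).
  have line (x v : 'M[R]_m) : setT x -> setT v -> \forall h \near (0 : R), setT (h *: v + x).
    by move=> _ _; exact: filterT.
  have [] : is_Ck 0 setT setT (fun A => f A i j).
    apply: is_Ck_mulmx => // k l; last exact: is_Ck_cst.
    apply: is_Ck_mulmx => // {}k {}l; first exact: is_Ck_cst.
    exact: is_Ck_coord.
  by move=> fc _; apply/continuous_subspace_setT.
exists [set A | forall i j, `|(f A - 1%:M) i j| < m.+1%:R^-1].
  rewrite openE => A /= fA.
  pose P i j B := `|(f B - 1%:M) i j| < m.+1%:R^-1.
  have FF : Filter (nbhs A) by exact: nbhs_filter.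
  have := @filter_forall _ _ (fun i => [set B | forall j, P i j B]) (nbhs A) FF; apply => i.
  have := @filter_forall _ _ (fun j => [set B | P i j B]) (nbhs A) FF; apply => j.
  apply: (cvgr_lt `|(f A - 1%:M) i j|); last exact: fA.
  have e B : (f B - 1%:M) i j = f B i j - (1%:M : 'M[R]_m) i j.
    by rewrite [LHS]mxE [X in _ + X]mxE.
  apply: cvg_norm; rewrite e; under eq_fun do rewrite e.
  by apply: cvgB; [exact: fc | exact: cvg_cst].
split=> [i j|A].
  rewrite /f eC !mulmxA mulVmx // mul1mx -trmx_mul mulVmx // trmx1 subrr.
  by rewrite mxE normr0 invr_gt0 ltr0n.
move=> /near1_posdef/posdef_congr => /(_ _ CtU).
by rewrite /f trmxK trmx_inv !mulmxA mulmxV // mul1mx mulmxKV.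
Qed.
End DefiniteLines.

(** * Homogeneous charts on the space of definite lines *)

Section Charts.
Variables (R : realType) (m : nat) (omega : 'M[R]_m).
Hypotheses (m0 : (0 < m)%N) (omegaT : omega^T = - omega) (omegaU : omega \in unitmx).
Local Notation E := (@symmetric_mx R m).
Implicit Types (C q : 'M[R]_m) (l : {vspace 'M[R]_m}).

(** The open set [P(S^2V^{>0})], the common domain of all the equations below. *)
Definition definite_lines : set {vspace 'M[R]_m} :=
  [set l | exists s, [/\ s^T = s, posdef s & l = <[s]>%VS]].

Lemma posdef_neq0 (s : 'M[R]_m) : posdef s -> s != 0.
Proof.
move=> posS; apply/eqP => s0.
have u0 : const_mx 1 != 0 :> 'cV[R]_m.
  by apply/eqP => /matrixP /(_ (Ordinal m0) 0) /eqP; rewrite !mxE oner_eq0.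
by have := posS _ u0; rewrite s0 /bilin mulmx0 mul0mx mxE ltxx.
Qed.

Lemma definite_linesP s : proj_lift E definite_lines s <->
  exists c t, [/\ c != 0, s = c *: t, t^T = t & posdef t].
Proof.
split=> [[Es s0 [t [symt post /line_eq [//|c c0 ->]]]]|[c [t [c0 -> symt post]]]].
  by exists c, t.
split; [exact: symmetricZ | by rewrite scaler_eq0 negb_or c0 posdef_neq0 |].
by exists t; split=> //; rewrite line_scale.
Qed.

Lemma definite_linesE s : proj_lift E definite_lines s <->
  s^T = s /\ (posdef s \/ posdef (- s)).
Proof.
split=> [/definite_linesP [c [t [c0 -> symt post]]]|[symS pos]].
  split; first exact: symmetricZ.
  have [cpos|cneg] := ltP 0 c; [left|right] => u /post tu.
    by rewrite bilinZ mulr_gt0.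
  by rewrite -scaleNr bilinZ mulr_gt0 // oppr_gt0 lt_neqAle c0.
apply/definite_linesP; case: pos => pos; first by exists 1, s; rewrite oner_eq0 scale1r.
exists (-1), (- s); rewrite scalerN scaleN1r opprK linearN /= symS; split=> //.
Qed.

Lemma definite_lines_open : Defs.proj_open E definite_lines.
Proof.
split=> [l [s [symS posS ->]]|]; first by exists s; split=> //; exact: posdef_neq0.
(* Every symmetric positive definite matrix has an open neighbourhood of positive definite matrices;
   the union [Op] of such sets meets [E] exactly in the positive cone. The lift also contains the
   negatives of that cone. *)
pose Op := \bigcup_(Q in [set Q : set 'M[R]_m | open Q /\ forall A, Q A -> posdef A]) Q.
have Opo : open Op by apply: bigcup_open => Q [].
have OpP s : s^T = s -> Op s <-> posdef s.
  move=> symS; split=> [[Q [_ QP] /QP //]|/(posdef_open symS) [Q Qo [Qs QP]]].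
  by exists Q.
exists (Op `|` -%R @^-1` Op).
  apply: openU => //; apply: open_comp => // s _; exact: opp_continuous.
apply/seteqP; split=> s.
  move=> /definite_linesE [symS pos]; split=> //; case: pos => pos; [left|right].
    exact/OpP.
  by apply/OpP; rewrite // linearN /= symS.
move=> [symS pos]; apply/definite_linesE; split=> //; case: pos => pos; [left|right].
  exact/OpP.
by apply/OpP; rewrite // linearN /= symS.
Qed.

(* Ratios of polynomials of the same degree in s, hence functions of the line. *)
Definition chart_quad C l : R := quad omega C (vpick l) / quad omega 1%:M (vpick l).
Definition chart_lin q l : R := \tr (q *m vpick l) / \tr (vpick l).

Lemma quadZ C a (s : 'M[R]_m) : quad omega C (a *: s) = a ^+ 2 * quad omega C s.
Proof. by rewrite /quad -!(scalemxAl, scalemxAr) !mxtraceZ expr2 mulrA. Qed.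

Lemma chart_quadE C s : chart_quad C <[s]>%VS = quad omega C s / quad omega 1%:M s.
Proof.
rewrite /chart_quad; have [a a0 ->] := vpick_line s; rewrite !quadZ.
by rewrite invfM mulrACA divff ?mul1r // expf_eq0.
Qed.

Lemma chart_linE q s : chart_lin q <[s]>%VS = \tr (q *m s) / \tr s.
Proof.
rewrite /chart_lin; have [a a0 ->] := vpick_line s.
by rewrite -scalemxAr !mxtraceZ invfM mulrACA divff ?mul1r.
Qed.

Fact dual_quad_is_linear s : linear (dual_quad omega s).
Proof.
move=> a C D; rewrite /dual_quad !(mulmxDr, mulmxDl) -!(scalemxAl, scalemxAr).
by rewrite scalerDr addrACA.
Qed.
HB.instance Definition _ s :=
  GRing.isLinear.Build R _ _ _ (dual_quad omega s) (dual_quad_is_linear s).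

(** The gradient of [chart_quad C] given by the quotient rule; [grad_lin] is that of
    [chart_lin q]. *)
Definition grad_quad (s C : 'M[R]_m) : 'M[R]_m :=
  (quad omega 1%:M s)^-1 *: dual_quad omega s C
  - (quad omega C s / quad omega 1%:M s ^+ 2) *: dual_quad omega s 1%:M.

Definition grad_lin (s q : 'M[R]_m) : 'M[R]_m :=
  (\tr s)^-1 *: q - (\tr (q *m s) / \tr s ^+ 2) *: 1%:M.

Fact grad_quad_is_linear s : linear (grad_quad s).
Proof.
move=> a C D; rewrite /grad_quad linearP /=.
have -> : quad omega (a *: C + D) s = a * quad omega C s + quad omega D s.
  by rewrite /quad mulmxDl -scalemxAl raddfD /= mxtraceZ.
rewrite scalerBr !scalerA scalerDr !scalerA !mulrDl !scalerDl opprD.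
by rewrite addrACA mulrC !mulrA.
Qed.
HB.instance Definition _ s := GRing.isLinear.Build R _ _ _ (grad_quad s) (grad_quad_is_linear s).

Fact grad_lin_is_linear s : linear (grad_lin s).
Proof.
move=> a C D; rewrite /grad_lin mulmxDl -scalemxAl mxtraceD mxtraceZ.
rewrite scalerBr !scalerA scalerDr !scalerA !mulrDl !scalerDl opprD.
by rewrite addrACA mulrC !mulrA.
Qed.
HB.instance Definition _ s := GRing.isLinear.Build R _ _ _ (grad_lin s) (grad_lin_is_linear s).

Lemma quad1_neq0 s : proj_lift E definite_lines s -> quad omega 1%:M s != 0.
Proof.
move=> /definite_linesP [c [t [c0 -> symt post]]].
by rewrite quadZ mulf_neq0 ?expf_neq0 // lt_eqF // quad1_lt0.
Qed.

Lemma posdef_trace_gt0 (s : 'M[R]_m) : posdef s -> 0 < \tr s.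
Proof.
move=> posS; have sii i : 0 < s i i.
  have := posS (delta_mx i 0); rewrite /bilin trmx_delta -rowE -colE !mxE; apply.
  by apply/eqP => /matrixP /(_ i 0) /eqP; rewrite !mxE !eqxx oner_eq0.
rewrite /mxtrace (bigD1 (Ordinal m0)) //= ltr_wpDr // sumr_ge0 // => i _; exact: ltW.
Qed.

Lemma trace_neq0 s : proj_lift E definite_lines s -> \tr s != 0.
Proof.
move=> /definite_linesP [c [t [c0 -> symt post]]].
by rewrite mxtraceZ mulf_neq0 // gt_eqF // posdef_trace_gt0.
Qed.

Lemma is_derive_quotient (N D : 'M[R]_m -> R) s v (dN dD : R) : D s != 0 ->
  is_derive s v N dN -> is_derive s v D dD ->
  is_derive s v (fun x => N x / D x) (dN / D s - N s * dD / D s ^+ 2).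
Proof.
move=> D0 [Nd eN] [Dd eD]; have Vd := derivableV D0 Dd.
split; first exact: derivableM Nd Vd.
rewrite (deriveM Nd Vd) deriveV // eN eD /GRing.scale /=.
by field.
Qed.

Lemma is_derive_quad C s v : is_derive s v (quad omega C) (\tr (dual_quad omega s C *m v)).
Proof.
rewrite dual_quadE.
apply: (@expansion_is_derive _ _ _ _ _ _ (quad omega C v)) => h.
rewrite /quad !(mulmxDl, mulmxDr, linearD) /= -!(scalemxAl, scalemxAr) !mxtraceZ.
by ring.
Qed.

Lemma is_derive_trace_mul q s v : is_derive s v (fun x => \tr (q *m x)) (\tr (q *m v)).
Proof.
apply: (@expansion_is_derive _ _ _ _ _ _ 0) => h.
by rewrite mulmxDr linearD /= -scalemxAr mxtraceZ; ring.
Qed.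

Lemma is_derive_chart_quad C s v : proj_lift E definite_lines s ->
  is_derive s v (fun x => chart_quad C <[x]>%VS) (\tr (grad_quad s C *m v)).
Proof.
move=> ls; have -> : (fun x => chart_quad C <[x]>%VS) =
    (fun x => quad omega C x / quad omega 1%:M x) by apply/funext => x; rewrite chart_quadE.
apply: is_derive_eq (is_derive_quotient (quad1_neq0 ls)
  (is_derive_quad C s v) (is_derive_quad 1%:M s v)) _.
rewrite /grad_quad mulmxBl linearB /= -!scalemxAl !mxtraceZ.
by congr (_ - _); [exact: mulrC | exact: mulrAC].
Qed.

Lemma is_derive_chart_lin q s v : proj_lift E definite_lines s ->
  is_derive s v (fun x => chart_lin q <[x]>%VS) (\tr (grad_lin s q *m v)).
Proof.
move=> ls; have -> : (fun x => chart_lin q <[x]>%VS) =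
    (fun x => \tr (q *m x) / \tr (1%:M *m x)).
  by apply/funext => x; rewrite chart_linE mul1mx.
have t0 : \tr (1%:M *m s) != 0 by rewrite mul1mx trace_neq0.
apply: is_derive_eq (@is_derive_quotient _ (fun x => \tr (1%:M *m x)) _ _ _ _ t0
  (is_derive_trace_mul q s v) (is_derive_trace_mul 1%:M s v)) _.
rewrite !mul1mx /grad_lin mulmxBl linearB /= -!scalemxAl !mxtraceZ mul1mx.
by congr (_ - _); [exact: mulrC | exact: mulrAC].
Qed.

Lemma grad_quad_sym C s : omega *m C = C^T *m omega -> s^T = s ->
  (grad_quad s C)^T = grad_quad s C.
Proof.
move=> oC symS; have dsym (D : 'M[R]_m) : omega *m D = D^T *m omega ->
    (dual_quad omega s D)^T = dual_quad omega s D.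
  move=> oD; rewrite /dual_quad linearD /= -!mulmxA oD !trmx_mul trmxK omegaT symS.
  by rewrite !(mulmxN, mulNmx, opprK) !mulmxA addrC.
by rewrite /grad_quad linearB !linearZ /= !dsym // trmx1 mulmx1 mul1mx.
Qed.

Lemma grad_lin_sym q (s : 'M[R]_m) : q^T = q -> (grad_lin s q)^T = grad_lin s q.
Proof. by move=> symq; rewrite /grad_lin linearB !linearZ /= trmx1 symq. Qed.

Lemma dual_quadZ a s C : dual_quad omega (a *: s) C = a *: dual_quad omega s C.
Proof. by rewrite /dual_quad -!(scalemxAl, scalemxAr) scalerDr. Qed.

Lemma grad_quadZ C a s : a != 0 -> grad_quad (a *: s) C = a^-1 *: grad_quad s C.
Proof.
move=> a0; rewrite /grad_quad !dual_quadZ !quadZ scalerBr !scalerA.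
(* When the denominator is 0, inverses are 0 by convention and both sides vanish. *)
have [->|q0] := eqVneq (quad omega 1%:M s) 0.
  by rewrite !(mulr0, expr0n, invr0, mul0r).
by congr (_ *: _ - _ *: _); field; rewrite ?a0 ?q0.
Qed.

Lemma grad_linZ q a (s : 'M[R]_m) : a != 0 -> grad_lin (a *: s) q = a^-1 *: grad_lin s q.
Proof.
move=> a0; rewrite /grad_lin -scalemxAr !mxtraceZ scalerBr !scalerA.
have [->|q0] := eqVneq (\tr s) 0.
  by rewrite !(mulr0, expr0n, invr0, mul0r).
by congr (_ *: _ - _ *: _); field; rewrite ?a0 ?q0.
Qed.

Let line := proj_open_line definite_lines_open.

Lemma quad_smooth C k : is_Ck k E (proj_lift E definite_lines) (quad omega C).
Proof.
have cst (M : 'M[R]_m) i j : is_Ck k E (proj_lift E definite_lines) (fun=> M i j).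
  exact: is_Ck_cst.
have id i j : is_Ck k E (proj_lift E definite_lines) (fun s => s i j) by exact: is_Ck_coord.
apply: is_Ck_mxtrace => //; do 5![apply: is_Ck_mulmx => //].
Qed.

Lemma trace_mul_smooth q k : is_Ck k E (proj_lift E definite_lines) (fun s => \tr (q *m s)).
Proof.
apply: is_Ck_mxtrace => //; apply: is_Ck_mulmx => // i j; first exact: is_Ck_cst.
exact: is_Ck_coord.
Qed.

Lemma chart_quad_smooth C :
  is_smooth E (proj_lift E definite_lines) (fun s => chart_quad C <[s]>%VS).
Proof.
move=> k; apply: (@is_Ck_eq _ _ _ _ line _ _ (fun s => quad omega C s * (quad omega 1%:M s)^-1)).
  by move=> s _; rewrite chart_quadE.
apply: is_CkM => //; first exact: quad_smooth.
by apply: is_CkV => // [s|]; [exact: quad1_neq0 | exact: quad_smooth].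
Qed.

Lemma chart_lin_smooth q :
  is_smooth E (proj_lift E definite_lines) (fun s => chart_lin q <[s]>%VS).
Proof.
move=> k; apply: (@is_Ck_eq _ _ _ _ line _ _ (fun s => \tr (q *m s) * (\tr (1%:M *m s))^-1)).
  by move=> s _; rewrite chart_linE mul1mx.
apply: is_CkM => //; first exact: trace_mul_smooth.
apply: is_CkV => // [s|]; last exact: trace_mul_smooth.
by rewrite mul1mx; exact: trace_neq0.
Qed.

End Charts.

(** * [X_Sp] as a submanifold *)

Section Submanifolds.
Variables (R : realType) (m : nat) (omega : 'M[R]_m).
Hypotheses (m0 : (0 < m)%N) (omegaT : omega^T = - omega) (omegaU : omega \in unitmx).
Variable s0 : 'M[R]_m.
Hypotheses (sym0 : s0^T = s0) (pos0 : posdef s0) (J0 : s0 *m omega *m s0 *m omega = - 1%:M).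
Local Notation E := (@symmetric_mx R m).
Local Notation W := (traceless_hermitian omega s0).
Implicit Types (C q s : 'M[R]_m) (l : {vspace 'M[R]_m}).

Lemma X_Sp_definite : X_Sp omega `<=` @definite_lines R m.
Proof. by move=> l /(X_SpP omegaT omegaU) [s [symS posS _ ->]]; exists s. Qed.

Lemma X_Sp_scalar s : s^T = s -> posdef s -> X_Sp omega <[s]>%VS ->
  exists2 lam, 0 < lam & s *m omega *m s *m omega = - lam%:M.
Proof.
move=> symS posS /(X_SpP omegaT omegaU) [t [symt post Jt /line_eq]].
move=> /(_ (posdef_neq0 m0 posS)) [c c0 ->]; exists (c ^+ 2); first by rewrite exprn_even_gt0.
by rewrite -!(scalemxAl, scalemxAr) Jt !scalerN scalerA -expr2 scalemx1.
Qed.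

(** On [X_Sp] the square [(s omega)^2] is scalar, so it pairs to 0 with trace-free [C]. Conversely
    the equations make it a scalar [mu], negative by its trace, and rescaling [s] by [(- mu)^(-1/2)]
    brings it to -1. *)
Lemma X_Sp_quad s : s^T = s -> posdef s ->
  (X_Sp omega <[s]>%VS <-> forall C, C \in W -> quad omega C s = 0).
Proof.
move=> symS posS; split=> [/(X_Sp_scalar symS posS) [lam lam0 eJ] C|quad0].
  move=> /(traceless_hermitianP omega) [_ _ trC]; rewrite /quad eJ mulmxN mul_mx_scalar.
  by rewrite linearN /= mxtraceZ trC mulr0 oppr0.
have eJ := quad_eq0_scalar omegaT omegaU m0 sym0 pos0 J0 symS posS quad0.
set mu := _ / _ in eJ; have mu0 : mu < 0.
  by rewrite pmulr_llt0 ?quad1_lt0 // invr_gt0 ltr0n.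
have r0 : 0 < (Num.sqrt (- mu))^-1 by rewrite invr_gt0 sqrtr_gt0 oppr_gt0.
apply/(X_SpP omegaT omegaU); exists ((Num.sqrt (- mu))^-1 *: s); split.
- by rewrite linearZ /= symS.
- by move=> u /posS su; rewrite bilinZ mulr_gt0.
- rewrite -!(scalemxAl, scalemxAr) eJ scalerA scale_scalar_mx -expr2 exprVn.
  rewrite sqr_sqrtr ?oppr_ge0 1?ltW // -raddfN /=; congr _%:M.
  by rewrite invrN mulNr mulVf // lt_eqF.
- by rewrite line_scale // gt_eqF.
Qed.

Lemma free_coord_eq0 k (X : k.-tuple 'M[R]_m) (a : 'I_k -> R) :
  free X -> \sum_i a i *: X`_i = 0 -> forall i, a i = 0.
Proof. by move=> /freeP; apply. Qed.

(** The correction term of the quotient rule turns [C] into [C - mu *: 1%:M], which still satisfies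
    both adjointness conditions. Hence [C] is scalar, and being trace-free it is 0. *)
Lemma grad_quad_inj C s : C \in W -> s^T = s -> posdef s -> grad_quad omega s C = 0 -> C = 0.
Proof.
move=> /(traceless_hermitianP omega) [Cs0 oC trC] symS posS.
have q0 : quad omega 1%:M s != 0 by rewrite lt_eqF // quad1_lt0.
pose mu := quad omega C s / quad omega 1%:M s.
have -> : grad_quad omega s C = (quad omega 1%:M s)^-1 *: dual_quad omega s (C - mu *: 1%:M).
  rewrite linearB linearZ /= scalerBr scalerA; congr (_ - _ *: _).
  by rewrite /mu; field.
move=> /eqP; rewrite scaler_eq0 invr_eq0 (negbTE q0) /= => /eqP e.
have eT : (C - mu *: 1%:M)^T = C^T - mu *: 1%:M by rewrite linearB linearZ /= trmx1.
have e' : C - mu *: 1%:M = 0.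
  apply: (dual_quad_inj omegaU sym0 pos0 _ _ symS posS e).
    rewrite mulmxBl eT mulmxBr Cs0 -scalemxAl -scalemxAr.
    by rewrite mul1mx mulmx1.
  rewrite mulmxBr eT mulmxBl oC -scalemxAl -scalemxAr.
  by rewrite mul1mx mulmx1.
have /eqP := congr1 (fun A => \tr A) e'.
rewrite raddfB /= mxtraceZ trC mxtrace1 raddf0 sub0r oppr_eq0 mulf_eq0 pnatr_eq0.
rewrite -[m == 0%N]negbK -lt0n m0 orbF => /eqP mu0.
by move: e'; rewrite mu0 scale0r subr0.
Qed.

(** One system of equations, indexed by a basis of [W], serves everywhere, since its gradients are
    independent at every definite line. *)
Lemma X_Sp_submanifold : is_submanifold E (\dim W) (X_Sp omega).
Proof.
have Dopen := definite_lines_open R m0.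
split=> [l /X_Sp_definite /(Dopen.1) //|x Xx].
pose phi (i : 'I_(\dim W)) := chart_quad omega ((vbasis W)`_i).
have Wi (i : 'I_(\dim W)) : (vbasis W)`_i \in W by apply/vbasis_mem/mem_nth; rewrite size_tuple.
have oC (i : 'I_(\dim W)) : omega *m (vbasis W)`_i = ((vbasis W)`_i)^T *m omega.
  by have /(traceless_hermitianP omega) [] := Wi i.
exists (@definite_lines R m), phi; split=> //; first exact: X_Sp_definite.
  apply: (@is_submersion_indep _ _ _ _ _ (fun i s => grad_quad omega s (vbasis W)`_i)).
  - by move=> i; exact: chart_quad_smooth.
  - by move=> i s v ls _; exact: is_derive_chart_quad.
  - by move=> i s symS; exact: grad_quad_sym.
  - move=> s /(definite_linesP m0) [c [t [c0 -> symt post]]] a.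
    rewrite (eq_bigr (fun i => c^-1 *: (a i *: grad_quad omega t (vbasis W)`_i))); last first.
      by move=> i _; rewrite grad_quadZ // scalerA mulrC -scalerA.
    rewrite -scaler_sumr => /eqP; rewrite scaler_eq0 invr_eq0 (negbTE c0) /= => /eqP.
    rewrite (eq_bigr (fun i => grad_quad omega t (a i *: (vbasis W)`_i))); last first.
      by move=> i _; rewrite linearZ.
    rewrite -raddf_sum => /(grad_quad_inj _ symt post) e.
    apply: (free_coord_eq0 (basis_free (vbasisP W))); apply: e.
    by apply: memv_suml => i _; exact: memvZ.
apply/seteqP; split=> l.
  move=> [Xl dl]; split=> // i; have [s [symS posS el]] := dl.
  rewrite /phi el chart_quadE; move: Xl; rewrite el => /(X_Sp_quad symS posS) -> //.
  by rewrite mul0r.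
move=> [[s [symS posS ->]] phi0]; split; last by exists s.
apply/X_Sp_quad => // C /coord_vbasis ->.
rewrite /quad mulmx_suml raddf_sum big1 // => i _.
rewrite /= -scalemxAl mxtraceZ; have := phi0 i; rewrite /phi chart_quadE => /eqP.
rewrite mulf_eq0 invr_eq0 (lt_eqF (quad1_lt0 omegaT omegaU m0 symS posS)) orbF /quad.
by move=> /eqP ->; rewrite mulr0.
Qed.

End Submanifolds.

(** * The intersection of [X_Sp] with the annihilator of the pencil *)

Section Intersection.
Variables (R : realType) (m : nat) (omega : 'M[R]_m).
Hypotheses (m0 : (0 < m)%N) (omegaT : omega^T = - omega) (omegaU : omega \in unitmx).
Variables (P : {vspace 'M[R]_m}) (regP : regular_pencil omega P).
Local Notation E := (@symmetric_mx R m).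
Implicit Types (C q s : 'M[R]_m) (l : {vspace 'M[R]_m}).

Lemma pencil_sym q : q \in P -> q^T = q.
Proof. by case: regP => [[_ +] _]; apply. Qed.

Lemma proj_annihilatorP s : s^T = s -> s != 0 ->
  (proj_space (pencil_annihilator P) <[s]>%VS <-> forall q, q \in P -> \tr (q *m s) = 0).
Proof.
move=> symS sn0; split=> [[t [[symt Pt] t0 /(line_eq sn0) [c c0 ->]]] q Pq|Ps].
  by rewrite -scalemxAr mxtraceZ Pt ?mulr0.
by exists s.
Qed.

Lemma pencil_basis : exists X : 2.-tuple 'M[R]_m, basis_of P X.
Proof.
have [[dimP _] _] := regP; have X2 : size (vbasis P) == 2%N by rewrite size_tuple dimP.
by exists (Tuple X2); exact: vbasisP.
Qed.

Variable s0 : 'M[R]_m.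
Hypotheses (sym0 : s0^T = s0) (pos0 : posdef s0) (J0 : s0 *m omega *m s0 *m omega = - 1%:M).
Local Notation W := (traceless_hermitian omega s0).

(** On the intersection [quad C s] and [tr (q s)] vanish, so the quotient-rule corrections disappear
    and the gradients are multiples of [dual_quad s C] and [q]. Clearing denominators replaces [q]
    by a multiple [q'] in [P], to which regularity applies. *)
Lemma grad_sum_inj C q s : C \in W -> q \in P -> s^T = s -> posdef s ->
  X_Sp omega <[s]>%VS -> proj_space (pencil_annihilator P) <[s]>%VS ->
  grad_quad omega s C + grad_lin s q = 0 -> C = 0 /\ q = 0.
Proof.
move=> CW Pq symS posS Xs /(proj_annihilatorP symS (posdef_neq0 m0 posS)) Ps.
have [lam lam0 eJ] := X_Sp_scalar m0 omegaT omegaU symS posS Xs.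
have quadC0 := (X_Sp_quad m0 omegaT omegaU sym0 pos0 J0 symS posS).1 Xs C CW.
have q10 : quad omega 1%:M s != 0 by rewrite lt_eqF // quad1_lt0.
have tr0 : \tr s != 0 by rewrite gt_eqF // posdef_trace_gt0.
rewrite /grad_quad /grad_lin quadC0 Ps // !mul0r !scale0r !subr0 => e.
pose q' := (quad omega 1%:M s / \tr s) *: q.
have Pq' : q' \in P by exact: memvZ.
have e' : dual_quad omega s C + q' = 0.
  have := congr1 (fun A => quad omega 1%:M s *: A) e.
  by rewrite scalerDr !scalerA divff // scale1r scaler0.
have [Cs0 oC _] : [/\ C *m s0 = s0 *m C^T, omega *m C = C^T *m omega & \tr C = 0].
  exact/(traceless_hermitianP omega).
have regq' : q' != 0 -> omega_regular omega q' by exact: regP.2.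
have [q0 ->] := regular_dual_quad_inj omegaT omegaU m0 sym0 pos0 Cs0 oC symS posS eJ lam0
  regq' (Ps _ Pq') e'.
split=> //; move/eqP: q0; rewrite scaler_eq0 mulf_eq0 invr_eq0 (negbTE q10) (negbTE tr0).
by move/eqP.
Qed.

(** Two linear equations from a basis of [P] are added to those of [X_Sp]. Independence is
    established at points of the intersection, whence the passage to a smaller neighbourhood by
    [shrink_submersion]. *)
Lemma X_Sp_annihilator_submanifold :
  is_submanifold E (\dim W + 2) (X_Sp omega `&` proj_space (pencil_annihilator P)).
Proof.
have Dopen := definite_lines_open R m0; have [X basisX] := pencil_basis.
split=> [l [/(X_Sp_definite omegaT omegaU)/(Dopen.1) //]|x [Xx Px]].
have [t0 [symt0 post0 et0]] := X_Sp_definite omegaT omegaU Xx.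
have Wi (i : 'I_(\dim W)) : (vbasis W)`_i \in W by apply/vbasis_mem/mem_nth; rewrite size_tuple.
have PX (j : 'I_2) : X`_j \in P by apply: (basis_mem basisX); rewrite mem_nth ?size_tuple.
pose phi (i : 'I_(\dim W + 2)) := match fintype.split i with
  | inl j => chart_quad omega (vbasis W)`_j | inr j => chart_lin X`_j end.
pose A (i : 'I_(\dim W + 2)) s := match fintype.split i with
  | inl j => grad_quad omega s (vbasis W)`_j | inr j => grad_lin s X`_j end.
have phi0 : (X_Sp omega `&` proj_space (pencil_annihilator P)) `&` @definite_lines R m =
    [set y | @definite_lines R m y /\ forall i, phi i y = 0].
  apply/seteqP; split=> l.
    move=> [[Xl Pl] dl]; split=> // i; have [s [symS posS el]] := dl.
    rewrite el in Xl Pl *; rewrite /phi; case: (fintype.split i) => j.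
      by rewrite chart_quadE ((X_Sp_quad m0 omegaT omegaU sym0 pos0 J0 symS posS).1 Xl) // mul0r.
    rewrite chart_linE ((proj_annihilatorP symS (posdef_neq0 m0 posS)).1 Pl) ?mul0r //.
  move=> [dl phil]; split=> //; have [s [symS posS el]] := dl; rewrite el in phil *; split.
    apply/(X_Sp_quad m0 omegaT omegaU sym0 pos0 J0 symS posS) => C /coord_vbasis ->.
    rewrite /quad mulmx_suml raddf_sum big1 // => i _.
    rewrite /= -scalemxAl mxtraceZ; have := phil (lshift 2 i).
    rewrite /phi; case: split_ordP => [j /lshift_inj <-|j /eqP]; last by rewrite eq_lrshift.
    rewrite chart_quadE => /eqP.
    rewrite mulf_eq0 invr_eq0 (lt_eqF (quad1_lt0 omegaT omegaU m0 symS posS)) orbF /quad.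
    by move=> /eqP ->; rewrite mulr0.
  apply/(proj_annihilatorP symS (posdef_neq0 m0 posS)) => q Pq.
  have -> : q = \sum_(i < 2) coord X i q *: X`_i by exact: (coord_basis basisX Pq).
  rewrite mulmx_suml raddf_sum big1 // => i _.
  rewrite /= -scalemxAl mxtraceZ; have := phil (rshift (\dim W) i).
  rewrite /phi; case: split_ordP => [j /eqP|j /rshift_inj <-]; first by rewrite eq_rlshift.
  rewrite chart_linE => /eqP; rewrite mulf_eq0 invr_eq0 (gt_eqF (posdef_trace_gt0 m0 posS)).
  by rewrite orbF => /eqP ->; rewrite mulr0.
have [||||||U [UD Uopen Ux subU]] :=
    @shrink_submersion _ _ _ (@definite_lines R m) phi A Dopen _ _ _ _ t0.
- move=> i; rewrite /phi; case: (fintype.split i) => j; first exact: chart_quad_smooth.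
  exact: chart_lin_smooth.
- move=> i s v ls _; rewrite /phi /A.
  case: (fintype.split i) => j; first exact: is_derive_chart_quad.
  exact: is_derive_chart_lin.
- move=> i s symS; rewrite /A; case: (fintype.split i) => j; last exact/grad_lin_sym/pencil_sym.
  by apply: grad_quad_sym => //; have /(traceless_hermitianP omega) [] := Wi j.
- move=> i a s a0; rewrite /A; case: (fintype.split i) => j; first exact: grad_quadZ.
  exact: grad_linZ.
- apply/(definite_linesP m0); exists 1, t0; by rewrite oner_eq0 scale1r.
- move=> a; rewrite big_split_ord /=.
  pose C := \sum_(i < \dim W) a (lshift 2 i) *: (vbasis W)`_i.
  pose q := \sum_(j < 2) a (rshift (\dim W) j) *: X`_j.
  have -> : \sum_(i < \dim W) a (lshift 2 i) *: A (lshift 2 i) t0 = grad_quad omega t0 C.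
    rewrite raddf_sum; apply: eq_bigr => i _; rewrite /= linearZ /A.
    by case: split_ordP => [j /lshift_inj <-|j /eqP]; last rewrite eq_lrshift.
  have -> : \sum_(j < 2) a (rshift (\dim W) j) *: A (rshift (\dim W) j) t0 = grad_lin t0 q.
    rewrite raddf_sum; apply: eq_bigr => i _; rewrite /= linearZ /A.
    by case: split_ordP => [j /eqP|j /rshift_inj <-]; first rewrite eq_rlshift.
  move=> /grad_sum_inj [] //.
  + by apply: memv_suml => i _; exact: memvZ.
  + by apply: memv_suml => i _; exact: memvZ.
  + by rewrite -et0.
  + by rewrite -et0.
  move=> C0 q0 i; case: (split_ordP i) => j ->.
    exact: (free_coord_eq0 (basis_free (vbasisP W)) C0).
  exact: (free_coord_eq0 (basis_free basisX) q0).
exists U, phi; split=> //; first by rewrite et0.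
apply/seteqP; split=> l.
  move=> [Nl Ul]; split=> //.
  have [] // : [set y | @definite_lines R m y /\ forall i, phi i y = 0] l.
  by rewrite -phi0; split=> //; exact: UD.
move=> [Ul phil]; split=> //.
have [] // : ((X_Sp omega `&` proj_space (pencil_annihilator P)) `&` @definite_lines R m) l.
by rewrite phi0; split=> //; exact: UD.
Qed.

End Intersection.

(** * Polynomial curves of matrices and their velocities *)

Section PolynomialCurves.
Variables (R : realType) (m : nat).
Local Notation E := (@symmetric_mx R m).
Implicit Types (G : 'M[{poly R}]_m).

(** Polynomial entries make smoothness automatic and reduce the product rule to formal
    differentiation. *)
Definition curve G (t : R) : 'M[R]_m := map_mx (horner_eval t) G.
Definition velocity G : 'M[R]_m := curve (map_mx (@deriv R) G) 0.
Definition affine_curve (a b : 'M[R]_m) : 'M[{poly R}]_m :=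
  map_mx polyC a + 'X *: map_mx polyC b.

Lemma curve_affine (a b : 'M[R]_m) t : curve (affine_curve a b) t = a + t *: b.
Proof. by apply/matrixP => i j; rewrite !mxE /horner_eval !hornerE. Qed.

Lemma velocity_affine (a b : 'M[R]_m) : velocity (affine_curve a b) = b.
Proof.
apply/matrixP => i j; rewrite !mxE /horner_eval.
by rewrite derivD derivM !derivC derivX mulr0 mul1r add0r addr0 hornerC.
Qed.

Lemma curveM G H t : curve (G *m H) t = curve G t *m curve H t.
Proof. exact: map_mxM. Qed.

Lemma curve_tr G t : curve G^T t = (curve G t)^T.
Proof. by apply/matrixP => i j; rewrite !mxE. Qed.

Lemma velocityM G H :
  velocity (G *m H) = velocity G *m curve H 0 + curve G 0 *m velocity H.
Proof.
rewrite /velocity; have -> : map_mx (@deriv R) (G *m H) =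
    map_mx (@deriv R) G *m H + G *m map_mx (@deriv R) H.
  apply/matrixP => i j; rewrite !mxE raddf_sum -big_split; apply: eq_bigr => k _ /=.
  by rewrite !mxE derivM.
by rewrite /curve map_mxD !map_mxM.
Qed.

Lemma velocity_tr G : velocity G^T = (velocity G)^T.
Proof. by apply/matrixP => i j; rewrite !mxE. Qed.

Lemma horner_Ck (D : set R) k (p : {poly R}) :
  (forall x v, D x -> setT v -> \forall h \near (0 : R), D (h *: v + x)) ->
  is_Ck k setT D (fun t => p.[t]).
Proof.
move=> DE; apply: (@is_Ck_eq _ _ _ _ DE _ _ (fun t => \sum_(i < size p) p`_i * \prod_(j < i) t)).
  by move=> t _; rewrite horner_coef; apply: eq_bigr => i _; rewrite prodr_const card_ord.
apply: is_Ck_sum => // i _; apply: is_CkM => //; first exact: is_Ck_cst.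
apply: is_Ck_prod => // _; case: k => [|k].
  by split=> //; apply: continuous_subspaceT => x; exact: cvg_id.
apply: is_CkS => // [|v _]; first by apply: continuous_subspaceT => x; exact: cvg_id.
exists (fun=> v); last exact: is_Ck_cst.
by move=> x _; exact: is_derive_id.
Qed.

Lemma curve_tangent X G (e : R) (s : 'M[R]_m) : 0 < e ->
  (forall t, ball (0 : R) e t -> proj_lift E X (curve G t)) -> curve G 0 = s ->
  lifted_tangent E X s (velocity G).
Proof.
move=> e0 XG Gs; exists e, (curve G); split=> // [k|].
  have line (x v : R) : ball (0 : R) e x -> setT v ->
      \forall h \near (0 : R), ball (0 : R) e (h *: v + x).
    move=> bx _; have nb : nbhs (0 *: v + x) (ball (0 : R) e).
      by rewrite scale0r add0r; apply: open_nbhs_nbhs; split=> //; exact: ball_open.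
    have : h *: v + x @[h --> (0 : R)] --> 0 *: v + x.
      by apply: cvgD; [apply: cvgZl; exact: cvg_id | exact: cvg_cst].
    by move=> /(_ _ nb).
  apply: is_Ck_mx => // i j; apply: (is_Ck_eq line _ (horner_Ck k (G i j) line)) => t _.
  by rewrite mxE.
have entry i j : is_derive (0 : R) 1 (fun t => curve G t i j) ((G i j)^`()).[0].
  have -> : (fun t => curve G t i j) = horner (G i j) by apply/funext => t; rewrite mxE.
  exact: is_derive_poly.
rewrite derive1E derive_mx; last by apply/derivable_mxP => i j; case: (entry i j).
apply/matrixP => i j; rewrite mxE (@derive_val _ _ _ _ _ _ _ (entry i j)).
by rewrite !mxE.
Qed.

End PolynomialCurves.

(** * Tangent vectors from the symplectic group, and transversality *)

Section Transversality.
Variables (R : realType) (m : nat) (omega : 'M[R]_m).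
Hypotheses (m0 : (0 < m)%N) (omegaT : omega^T = - omega) (omegaU : omega \in unitmx).
Local Notation E := (@symmetric_mx R m).
Implicit Types (q s p : 'M[R]_m).

(** For symmetric [p], [p omega] is an element of the symplectic Lie algebra; polynomial curves in
    the group replace the exponential map. *)
Definition symplectic_velocity p := exists A : 'M[{poly R}]_m,
  [/\ forall t, (curve A t)^T *m omega *m curve A t = omega, curve A 0 = 1%:M &
      velocity A = p *m omega].

Lemma symplectic_velocityD p q :
  symplectic_velocity p -> symplectic_velocity q -> symplectic_velocity (p + q).
Proof.
move=> [A [Ao A0 Av]] [B [Bo B0 Bv]]; exists (A *m B); split=> [t||].
- rewrite curveM trmx_mul.
  have -> : (curve B t)^T *m (curve A t)^T *m omega *m (curve A t *m curve B t) =
    (curve B t)^T *m ((curve A t)^T *m omega *m curve A t) *m curve B t by rewrite !mulmxA.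
  by rewrite Ao Bo.
- by rewrite curveM A0 B0 mulmx1.
- by rewrite velocityM A0 B0 Av Bv mulmx1 mul1mx mulmxDl.
Qed.

Lemma symplectic_velocity0 : symplectic_velocity 0.
Proof.
exists (affine_curve 1%:M 0); split=> [t||]; rewrite ?velocity_affine ?curve_affine.
- by rewrite scaler0 addr0 trmx1 mulmx1 mul1mx.
- by rewrite scaler0 addr0.
- by rewrite mul0mx.
Qed.

(* The transvections 1 + t a x x^T omega. *)
Lemma symplectic_velocity_rank1 a (x : 'cV[R]_m) : symplectic_velocity (a *: (x *m x^T)).
Proof.
exists (affine_curve 1%:M (a *: (x *m x^T) *m omega)); split=> [t||].
- rewrite curve_affine -scalemxAl scalerA; set N := x *m x^T *m omega; set b := t * a.
  have NT : N^T *m omega = - (omega *m N).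
    by rewrite /N !trmx_mul trmxK omegaT !mulNmx !mulmxA.
  have xx : x^T *m omega *m x = 0.
    apply/matrixP => i j; rewrite !ord1 [RHS]mxE; exact: bilin_skew.
  have NN : N *m N = 0.
    have -> : N *m N = x *m (x^T *m omega *m x) *m x^T *m omega by rewrite !mulmxA.
    by rewrite xx mulmx0 !mul0mx.
  have -> : (1%:M + b *: N)^T = 1%:M + b *: N^T by rewrite linearD linearZ /= trmx1.
  rewrite mulmxDl mul1mx mulmxDr mulmx1 -!scalemxAl NT -!scalemxAr mulmxDl.
  by rewrite -scalemxAl mulNmx -mulmxA NN mulmx0 oppr0 scaler0 addr0 scalerN addrNK.
- by rewrite curve_affine scale0r addr0.
- by rewrite velocity_affine.
Qed.

(** Polarisation: [(e_i + e_j)(e_i + e_j)^T - e_i e_i^T - e_j e_j^T = E_ij + E_ji] writes [p] as a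
    sum of multiples of rank-one squares, and multiplying curves adds their velocities. *)
Lemma symplectic_velocity_sym p : p^T = p -> symplectic_velocity p.
Proof.
move=> symp.
have -> : p = \sum_i \sum_j (
   (p i j / 2) *: ((delta_mx i 0 + delta_mx j 0) *m
                   (delta_mx i 0 + delta_mx j 0 : 'cV_m)^T)
   + (- (p i j / 2)) *: (delta_mx i 0 *m (delta_mx i 0 : 'cV_m)^T)
   + (- (p i j / 2)) *: (delta_mx j 0 *m (delta_mx j 0 : 'cV_m)^T)).
  have pT : p^T = \sum_i \sum_j p i j *: delta_mx j i.
    rewrite {1}(matrix_sum_delta p) raddf_sum; apply: eq_bigr => i _.
    rewrite raddf_sum; apply: eq_bigr => j _.
    by rewrite /= linearZ /= trmx_delta.
  have phalf : p = 2^-1 *: (p + p^T).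
    by rewrite symp; apply/matrixP => i j; rewrite !mxE; field.
  rewrite [LHS]phalf pT {1}(matrix_sum_delta p) -big_split scaler_sumr.
  apply: eq_bigr => i _; rewrite /= -big_split scaler_sumr; apply: eq_bigr => j _.
  have -> : (delta_mx i 0 + delta_mx j 0 : 'cV[R]_m)^T = delta_mx 0 i + delta_mx 0 j.
    by rewrite linearD /= !trmx_delta.
  rewrite !trmx_delta !(mulmxDl, mulmxDr) !mul_delta_mx.
  by apply/matrixP => k l; rewrite !mxE; field.
apply: big_ind => [||i _]; [exact: symplectic_velocity0 | exact: symplectic_velocityD |].
apply: big_ind => [||j _]; [exact: symplectic_velocity0 | exact: symplectic_velocityD |].
apply: symplectic_velocityD; last exact: symplectic_velocity_rank1.
by apply: symplectic_velocityD; exact: symplectic_velocity_rank1.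
Qed.

(** Since [A^T omega = omega A^-1], the action of [A] on tensors conjugates [s omega] by [A]. *)
Lemma X_Sp_symplectic (A s : 'M[R]_m) : A^T *m omega *m A = omega ->
  X_Sp omega <[s]>%VS -> s != 0 -> A *m s *m A^T != 0 /\ X_Sp omega <[A *m s *m A^T]>%VS.
Proof.
move=> Ao /(X_SpP omegaT omegaU) [t [symt post Jt /line_eq e]] /e [c c0 ->].
have AU : A \in unitmx by move: omegaU; rewrite -{1}Ao unitmx_mul => /andP[].
rewrite -scalemxAr -scalemxAl.
have posA : posdef (A *m t *m A^T).
  by rewrite -[X in X *m _ *m _]trmxK; apply: posdef_congr; rewrite ?unitmx_tr.
split; first by rewrite scaler_eq0 negb_or c0 posdef_neq0.
rewrite line_scale //; apply/(X_SpP omegaT omegaU); exists (A *m t *m A^T); split=> //.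
  by rewrite !trmx_mul trmxK symt mulmxA.
have Aoi : A^T *m omega = omega *m invmx A by rewrite -[in RHS]Ao mulmxK.
rewrite -(mulmxA _ A^T omega) Aoi !mulmxA.
have -> : A *m t *m omega *m invmx A *m A *m t *m A^T *m omega =
  A *m t *m omega *m (invmx A *m A) *m t *m (A^T *m omega) by rewrite !mulmxA.
rewrite mulVmx // mulmx1 Aoi.
have -> : A *m t *m omega *m t *m (omega *m invmx A) =
  A *m (t *m omega *m t *m omega) *m invmx A by rewrite !mulmxA.
by rewrite Jt mulmxN mulmx1 mulNmx mulmxV.
Qed.

(** The vector is the velocity at 0 of [A s A^T], where [A] is a symplectic curve with velocity
    [p omega]. *)
Lemma X_Sp_tangent p s : p^T = p -> s^T = s -> s != 0 -> X_Sp omega <[s]>%VS ->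
  lifted_tangent E (X_Sp omega) s (p *m omega *m s - s *m omega *m p).
Proof.
move=> /[dup] symp /symplectic_velocity_sym [A [Ao A0 Av]] symS sn0 Xs.
pose G := A *m affine_curve s 0 *m A^T.
have GE t : curve G t = curve A t *m s *m (curve A t)^T.
  by rewrite !curveM curve_tr curve_affine scaler0 addr0.
have -> : p *m omega *m s - s *m omega *m p = velocity G.
  rewrite !velocityM curveM curve_tr !velocity_tr A0 Av velocity_affine curve_affine.
  rewrite trmx1 !trmx_mul omegaT symp !(mulmx1, mul1mx, mulmx0, scaler0, addr0).
  by rewrite mulNmx mulmxN mulmxA.
apply: (@curve_tangent _ _ _ _ 1) => // [t _|]; last by rewrite GE A0 trmx1 mulmx1 mul1mx.
have [n0 XG] := X_Sp_symplectic (Ao t) Xs sn0.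
by rewrite GE; split=> //; rewrite /symmetric_mx /= !trmx_mul trmxK symS mulmxA.
Qed.

(** The straight line [s + t w] stays in the annihilator, and for small [t] it avoids 0 because
    definite lines form an open set. *)
Lemma annihilator_tangent P s w : proj_lift E (@definite_lines R m) s ->
  pencil_annihilator P s -> pencil_annihilator P w ->
  lifted_tangent E (proj_space (pencil_annihilator P)) s w.
Proof.
move=> ls [symS Ps] [symw Pw].
have [e /= e0 be] : \forall h \near (0 : R), proj_lift E (@definite_lines R m) (h *: w + s).
  exact: (proj_open_line (definite_lines_open R m0)).
rewrite -(velocity_affine s w); apply: (curve_tangent e0) => [t bt|].
  rewrite curve_affine addrC; have [Et n0 _] := be t bt; split=> //.
  exists (t *: w + s); split=> //; split=> // q Pq.
  by rewrite mulmxDr raddfD /= -scalemxAr mxtraceZ Pw // Ps // mulr0 addr0.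
by rewrite curve_affine scale0r addr0.
Qed.

(** A symmetric [p] is sought whose tangent vector [w1] pairs with [P] as [w] does. Since [tr (q w1)
    = tr ((omega s q - q s omega) p)], solvability follows from independence of the matrices [A j];
    a relation among them would give a nonzero [q] in [P] with [omega s q = q s omega], hence
    [tr (q t) > 0]. *)
Lemma X_Sp_transverse P : regular_pencil omega P ->
  transverse E (X_Sp omega) (proj_space (pencil_annihilator P)).
Proof.
move=> regP s [symS sn0 [Xs Ps]] w symw.
have [X basisX] := pencil_basis regP.
have PX (j : 'I_2) : X`_j \in P by apply: (basis_mem basisX); rewrite mem_nth ?size_tuple.
have trs := (proj_annihilatorP P symS sn0).1 Ps.
have [t [symt post Jt /line_eq e]] := (X_SpP omegaT omegaU _).1 Xs.
have [c c0 es] := e sn0.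
have trt q : q \in P -> \tr (q *m t) = 0.
  move=> /trs; rewrite es -scalemxAr mxtraceZ => /eqP.
  by rewrite mulf_eq0 (negbTE c0) => /eqP.
pose A (j : 'I_2) := omega *m s *m X`_j - X`_j *m s *m omega.
have symA j : (A j)^T = A j.
  rewrite /A linearB /= !trmx_mul (pencil_sym regP (PX j)) symS omegaT.
  by rewrite !(mulmxN, mulNmx) opprK addrC !mulmxA.
have freeA (a : 'I_2 -> R) : \sum_j a j *: A j = 0 -> forall j, a j = 0.
  move=> eA; pose q := \sum_j a j *: X`_j.
  have Pq : q \in P by apply: memv_suml => j _; exact: memvZ.
  have eq : omega *m t *m q = q *m t *m omega.
    apply: (scalerI c0); have : omega *m s *m q = q *m s *m omega.
      apply/eqP; rewrite -subr_eq0 -eA /q mulmx_sumr !mulmx_suml -sumrB; apply/eqP.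
      by apply: eq_bigr => j _; rewrite scalerBr -!(scalemxAl, scalemxAr).
    by rewrite es -!(scalemxAl, scalemxAr).
  have q0 : q = 0.
    apply: contra_eq (trt q Pq) => /(regP.2 q Pq) [Lp [_ [lagL _ posL _]]].
    by rewrite gt_eqF // (lagrangian_trace_gt0 omegaT m0 symt post Jt ltr01 eq lagL).
  exact: (free_coord_eq0 (basis_free basisX) q0).
have [p symp pw] := trace_dual_surjective symA freeA (fun j => \tr (X`_j *m w)).
pose w1 := p *m omega *m s - s *m omega *m p.
have symw1 : w1^T = w1.
  rewrite /w1 linearB /= !trmx_mul symp symS omegaT !(mulmxN, mulNmx) opprK addrC !mulmxA //.
exists w1, (w - w1); split; last by rewrite addrC subrK.
  exact: X_Sp_tangent.
apply: annihilator_tangent.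
- by apply/(definite_linesP m0); exists c, t.
- by split.
split=> [|q Pq]; first by rewrite /symmetric_mx /= linearB /= symw symw1.
have -> : q = \sum_(i < 2) coord X i q *: X`_i by exact: (coord_basis basisX Pq).
rewrite mulmx_suml raddf_sum big1 // => j _.
rewrite /= -scalemxAl mxtraceZ mulmxBr raddfB /= -pw.
suff -> : \tr (X`_j *m w1) = \tr (A j *m p) by rewrite subrr mulr0.
rewrite /w1 /A mulmxBr mulmxBl !raddfB /= !mulmxA; congr (_ - _).
by rewrite -!mulmxA mulmxA mxtrace_mulC !mulmxA.
Qed.

End Transversality.

Theorem lemma7p4 (R : realType) (n : nat) (omega : 'M[R]_(2 * n))
    (homega : symplectic_form omega)
    (P : {vspace 'M[R]_(2 * n)}) (hP : regular_pencil omega P) :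
  transverse (@symmetric_mx R (2 * n))
    (X_Sp omega) (proj_space (pencil_annihilator P)) /\
  is_submanifold_in (@symmetric_mx R (2 * n)) 2
    (X_Sp omega) (setI (X_Sp omega) (proj_space (pencil_annihilator P))).
Proof.
have [omegaT omegaU] := homega.
(* A plane of matrices exists, so the matrix size is positive. *)
have m0 : (0 < 2 * n)%N.
  have := dimvS (subvf P); rewrite dimvf hP.1.1 /dim /=.
  by case: (2 * n)%N.
split; first exact: X_Sp_transverse.
split; first exact: subIsetl.
(* The equations need a base tensor [s0] from [X_Sp]; in the empty case both sets are empty, and the
   empty set has every codimension. *)
have [[x Xx]|X0] := pselect (exists x, X_Sp omega x); last first.
  have empty l : ~ X_Sp omega l by move=> Xl; apply: X0; exists l.
  by exists 0%N; split; split=> l; first [by move/empty | by case=> /empty].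
have [s0 [sym0 pos0 J0 _]] := (X_SpP omegaT omegaU x).1 Xx.
exists (\dim (traceless_hermitian omega s0)); split.
  exact: X_Sp_submanifold.
exact: X_Sp_annihilator_submanifold.
Qed.
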